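(* The minimal index of a proper subgroup of ${\rm SOut}\, F_4$ is eight, and the minimal index of a proper subgroup of ${\rm Out}\, F_4$ different from ${\rm SOut}\, F_4$ is also eight (eight being the minimal index of a proper subgroup of ${\rm PSL}_4(\mathbb{Z}_2) \cong \mathbb{A}_8$).
   Context: $F_4$ is the free group of rank $4$, and ${\rm Out}\, F_4 = {\rm Aut}\, F_4 / {\rm Inn}\, F_4$ is its outer automorphism group. The action on the abelianization $F_4^{\rm ab} \cong \mathbb{Z}^4$ gives a canonical surjection ${\rm Out}\, F_4 \to {\rm GL}_4(\mathbb{Z})$; ${\rm SOut}\, F_4$ denotes the preimage of ${\rm SL}_4(\mathbb{Z})$ under this surjection (a subgroup of index two in ${\rm Out}\, F_4$). $\mathbb{Z}_2 = \mathbb{Z}/2\mathbb{Z}$ is the field with two elements, and $\mathbb{A}_8$ is the alternating group of degree $8$. *)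

(* Defs.v *)
From HB Require Import structures.
From mathcomp Require Import all_boot all_order all_algebra all_fingroup.
From mathcomp Require Import all_solvable.
From mathcomp Require Import boolp classical_sets functions cardinality.

Set Implicit Arguments.
Unset Strict Implicit.
Unset Printing Implicit Defensive.

Import GRing.Theory.
Local Open Scope group_scope.
Local Open Scope quotient_scope.

(* The letter (i, true) stands for the generator x_i and (i, false) for its
   inverse; the elements of the free group are the words without two
   consecutive mutually inverse letters. *)
Section FreeGroup.
Variable n : nat.

Definition letter : Type := 'I_n * bool.
HB.instance Definition _ := Countable.on letter.

Definition linv (a : letter) : letter := (a.1, ~~ a.2).

Definition reduced (w : seq letter) : bool :=
  sorted (fun a b => b != linv a) w.

Record free_group := FreeGroup { fword :> seq letter; _ : reduced fword }.
HB.instance Definition _ := [isSub for fword].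
HB.instance Definition _ := [Countable of free_group by <:].

Definition push (a : letter) (w : seq letter) : seq letter :=
  if w is b :: w' then if b == linv a then w' else a :: w else [:: a].

Definition act_word (s w : seq letter) : seq letter := foldr push w s.

Definition inv_word (s : seq letter) : seq letter := rev (map linv s).

Lemma linvK : involutive linv.
Proof. by case=> i b; rewrite /linv /= negbK. Qed.

Lemma reduced_tail a w : reduced (a :: w) -> reduced w.
Proof. by case: w => //= b w /andP[]. Qed.

Lemma push_reduced a w : reduced w -> reduced (push a w).
Proof.
case: w => //= b w; case: ifP => [_|nb] wr; first exact: (@reduced_tail b).
by rewrite /= nb.
Qed.

Lemma pushK a w : reduced w -> push (linv a) (push a w) = w.
Proof.
case: w => [|b w] /=; first by rewrite linvK eqxx.
case: eqP => [-> |_] /=; last by rewrite linvK eqxx.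
case: w => [|c w] //= /andP[/negPf->]; by [].
Qed.

Lemma act_word_reduced s w : reduced w -> reduced (act_word s w).
Proof. by move=> wr; elim: s => //= a s; apply: push_reduced. Qed.

Lemma act_word_nil s : reduced s -> act_word s [::] = s.
Proof.
elim: s => //= a s IHs sr; rewrite IHs; last exact: (@reduced_tail a).
by case: s sr {IHs} => //= b s /andP[/negPf->].
Qed.

Lemma act_word_push a t w :
  reduced w -> act_word (push a t) w = push a (act_word t w).
Proof.
move=> wr; case: t => //= b t; case: eqP => //= ->.
by rewrite -{1}[a]linvK pushK //; apply: act_word_reduced.
Qed.

Lemma act_wordA s t w :
  reduced w -> act_word (act_word s t) w = act_word s (act_word t w).
Proof.
by move=> wr; elim: s => //= a s IHs; rewrite act_word_push // IHs.
Qed.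

Lemma inv_wordK : involutive inv_word.
Proof. by move=> s; rewrite /inv_word map_rev revK (mapK linvK). Qed.

Lemma inv_word_act s : act_word (inv_word s) s = [::].
Proof.
elim: s => //= a s IHs.
by rewrite /inv_word /= rev_cons /act_word foldr_rcons /= linvK eqxx.
Qed.

Lemma inv_word_reduced s : reduced s -> reduced (inv_word s).
Proof.
rewrite /reduced /inv_word rev_sorted sorted_map; apply: sub_sorted => a b /=.
by apply: contra_neq => ->; rewrite !linvK.
Qed.

Definition fg_one : free_group := @FreeGroup [::] isT.
Definition fg_mul (u v : free_group) : free_group :=
  FreeGroup (act_word_reduced u (valP v)).
Definition fg_inv (u : free_group) : free_group :=
  FreeGroup (inv_word_reduced (valP u)).

Fact fg_mulA : associative fg_mul.
Proof. by move=> u v w; apply: val_inj; rewrite /= act_wordA // (valP w). Qed.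

Fact fg_mul1 : left_id fg_one fg_mul.
Proof. by move=> u; apply: val_inj. Qed.

Fact fg_1mul : right_id fg_one fg_mul.
Proof. by move=> u; apply: val_inj; rewrite /= act_word_nil // (valP u). Qed.

Fact fg_mulV : left_inverse fg_one fg_inv fg_mul.
Proof. by move=> u; apply: val_inj; rewrite /= inv_word_act. Qed.

Fact fg_Vmul : right_inverse fg_one fg_inv fg_mul.
Proof.
by move=> u; apply: val_inj; rewrite /= -{1}[fword u]inv_wordK inv_word_act.
Qed.

HB.instance Definition _ :=
  isGroup.Build free_group fg_mulA fg_mul1 fg_1mul fg_mulV fg_Vmul.

Definition fgen (i : 'I_n) : free_group := @FreeGroup [:: (i, true)] isT.

Lemma free_group_ind (P : free_group -> Prop) :
  P 1 -> (forall i x, P x -> P (fgen i * x)) ->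
  (forall i x, P x -> P ((fgen i)^-1 * x)) -> forall x, P x.
Proof.
move=> P1 PM PV [w wr]; elim: w wr => [|[i b] w IHw] wr.
  by rewrite (_ : FreeGroup wr = 1) //; apply: val_inj.
have wr' := reduced_tail wr.
suff -> : FreeGroup wr = (if b then fgen i else (fgen i)^-1) * FreeGroup wr'.
  by case: b {wr} => /=; [apply: PM | apply: PV].
apply: val_inj; case: b w wr wr' {IHw} => -[|c w] //= /andP[cE _] _;
  by rewrite (negPf cE).
Qed.

End FreeGroup.

Lemma free_group_universal n (G : groupType) (h : 'I_n -> G) :
  exists f : free_group n -> G,
    [/\ monoid.monoid_morphism f, forall i, f (fgen i) = h i &
        forall g : free_group n -> G, monoid.monoid_morphism g ->
          (forall i, g (fgen i) = h i) -> g =1 f].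
Proof.
pose hl (a : letter n) := if a.2 then h a.1 else (h a.1)^-1.
pose F (w : seq (letter n)) := foldr (fun a x => hl a * x) 1 w.
have hlV a : hl (linv a) = (hl a)^-1.
  by case: a => i []; rewrite /hl //= invgK.
have FP a w : F (push a w) = hl a * F w.
  case: w => //= b w; case: eqP => //= ->.
  by rewrite hlV mulgA mulgV mul1g.
have FM s t : F (act_word s t) = F s * F t.
  by elim: s => /= [|a s IHs]; rewrite ?mul1g // FP IHs mulgA.
exists (fun x => F x); split; first by split=> // x y; apply: FM.
- by move=> i; rewrite /= /hl /= mulg1.
move=> g [g1 gM] gh; have gV x : g x^-1 = (g x)^-1.
  by apply: (mulgI (g x)); rewrite -gM !mulgV g1.
apply: free_group_ind => [|i x IHx|i x IHx]; first by rewrite g1.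
  by rewrite gM IHx FM gh /= mulg1.
by rewrite gM gV IHx FM gh /= mulg1.
Qed.

Section Automorphisms.
Variable G : groupType.

Definition is_aut (f : G -> G) : Prop := bijective f /\ {morph f : x y / x * y}.

Record aut := Aut { aut_fun :> G -> G; autP : is_aut aut_fun }.
HB.instance Definition _ := gen_eqMixin aut.
HB.instance Definition _ := gen_choiceMixin aut.

Lemma aut_eq (f g : aut) : f =1 g -> f = g.
Proof.
case: f g => [f Pf] [g Pg] /= /funext fg; rewrite fg in Pf *.
by congr Aut; apply: Prop_irrelevance.
Qed.

Lemma autM (f : aut) : {morph f : x y / x * y}.
Proof. by case: f => f []. Qed.

Lemma aut_bij (f : aut) : bijective f.
Proof. by case: f => f []. Qed.

Lemma aut1 (f : aut) : f 1 = 1.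
Proof. by apply: (mulgI (f 1)); rewrite -autM !mulg1. Qed.

Lemma autV (f : aut) x : f x^-1 = (f x)^-1.
Proof. by apply: (mulgI (f x)); rewrite -autM !mulgV aut1. Qed.

Lemma aut_inv_ex (f : aut) : exists g : G -> G, cancel f g /\ cancel g f.
Proof. by case: (aut_bij f) => g fK gK; exists g. Qed.

Definition aut_inv_fun (f : aut) : G -> G := sval (cid (aut_inv_ex f)).

Lemma aut_invK (f : aut) : cancel f (aut_inv_fun f).
Proof. by rewrite /aut_inv_fun; case: cid => g []. Qed.

Lemma aut_Kinv (f : aut) : cancel (aut_inv_fun f) f.
Proof. by rewrite /aut_inv_fun; case: cid => g []. Qed.

Fact aut_id_subproof : is_aut id.
Proof. by split=> //; exists id. Qed.

Fact aut_comp_subproof (f g : aut) : is_aut (f \o g).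
Proof.
split; first exact: bij_comp (aut_bij f) (aut_bij g).
by move=> x y /=; rewrite !autM.
Qed.

Fact aut_inv_subproof (f : aut) : is_aut (aut_inv_fun f).
Proof.
split; first by exists f; [apply: aut_Kinv | apply: aut_invK].
move=> x y; apply: (can_inj (aut_invK f)).
by rewrite autM !aut_Kinv.
Qed.

Definition aut_id : aut := Aut aut_id_subproof.
Definition aut_comp (f g : aut) : aut := Aut (aut_comp_subproof f g).
Definition aut_inv (f : aut) : aut := Aut (aut_inv_subproof f).

Fact aut_compA : associative aut_comp.
Proof. by move=> f g h; apply: aut_eq. Qed.
Fact aut_comp1 : left_id aut_id aut_comp.
Proof. by move=> f; apply: aut_eq. Qed.
Fact aut_1comp : right_id aut_id aut_comp.
Proof. by move=> f; apply: aut_eq. Qed.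
Fact aut_compV : left_inverse aut_id aut_inv aut_comp.
Proof. by move=> f; apply: aut_eq => x /=; rewrite aut_invK. Qed.
Fact aut_Vcomp : right_inverse aut_id aut_inv aut_comp.
Proof. by move=> f; apply: aut_eq => x /=; rewrite aut_Kinv. Qed.

HB.instance Definition _ :=
  isGroup.Build aut aut_compA aut_comp1 aut_1comp aut_compV aut_Vcomp.

Definition inner : set aut := [set f | exists c, forall x, f x = c * x * c^-1].

Lemma inner1 : inner 1.
Proof. by exists 1 => x; rewrite /= invg1 mulg1 mul1g. Qed.

Lemma innerM f g : inner f -> inner g -> inner (f * g).
Proof.
case=> c fE [d gE]; exists (c * d) => x.
by rewrite [LHS]/= fE gE invgM !mulgA.
Qed.

Lemma innerV f : inner f -> inner f^-1.
Proof.
case=> c fE; exists c^-1 => x; apply: (can_inj (aut_invK f)).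
by rewrite [LHS](aut_Kinv f) fE !mulgA mulgV mul1g invgK mulgK.
Qed.

Lemma innerJ f g : inner g -> inner (f^-1 * g * f).
Proof.
case=> c gE; exists (f^-1 c) => x; apply: (can_inj (aut_invK f)).
rewrite [in RHS]autM [in RHS]autM [in RHS]autV.
by rewrite ![f (f^-1 _)](aut_Kinv f) gE.
Qed.

Definition out_rel (f g : aut) : bool := `[< inner (f^-1 * g) >].

Fact out_rel_refl : reflexive out_rel.
Proof. by move=> f; apply/asboolP; rewrite mulVg; apply: inner1. Qed.

Fact out_rel_sym : symmetric out_rel.
Proof.
by move=> f g; apply/asboolP/asboolP => /innerV; rewrite invgM invgK.
Qed.

Fact out_rel_trans : transitive out_rel.
Proof.
move=> g f h /asboolP fg /asboolP gh; apply/asboolP.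
by have := innerM fg gh; rewrite mulgA mulgK.
Qed.

Canonical out_equiv := EquivRel out_rel out_rel_refl out_rel_sym out_rel_trans.

Definition out : Type := {eq_quot out_equiv}.
HB.instance Definition _ := Choice.on out.
HB.instance Definition _ := Quotient.on out.

Definition outer (f : aut) : out := \pi_out f.
Definition out_repr (u : out) : aut := generic_quotient.repr u.

Lemma outerP f g : reflect (inner (f^-1 * g)) (outer f == outer g).
Proof.
apply: (iffP eqP) => [/eqmodP/asboolP //|fg].
by apply/eqmodP/asboolP.
Qed.

Lemma outer_repr (u : out) : outer (out_repr u) = u.
Proof. exact: reprK. Qed.

Lemma repr_outer f : inner ((out_repr (outer f))^-1 * f).
Proof. by apply/outerP; rewrite outer_repr. Qed.

Definition out_one : out := outer 1.
Definition out_mul (u v : out) : out :=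
  outer (out_repr u * out_repr v).
Definition out_inv (u : out) : out := outer (out_repr u)^-1.

Lemma out_mulE f g : out_mul (outer f) (outer g) = outer (f * g).
Proof.
apply/eqP/outerP; set f' := out_repr _.
set g' := out_repr _.
have -> : (f' * g')^-1 * (f * g) = g'^-1 * (f'^-1 * f) * g' * (g'^-1 * g).
  by rewrite invgM !mulgA mulgK.
by apply: innerM; [apply: innerJ|]; apply: repr_outer.
Qed.

Lemma out_invE f : out_inv (outer f) = outer f^-1.
Proof.
apply/eqP/outerP; set f' := out_repr _; rewrite invgK.
have -> : f' * f^-1 = f'^-1^-1 * (f'^-1 * f)^-1 * f'^-1.
  by rewrite invgM !invgK mulgA mulgK.
by apply/innerJ/innerV/repr_outer.
Qed.

Lemma outer_surj (u : out) : exists f, u = outer f.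
Proof. by exists (out_repr u); rewrite outer_repr. Qed.

Fact out_mulA : associative out_mul.
Proof.
move=> u v w; have [f ->] := outer_surj u; have [g ->] := outer_surj v.
by have [h ->] := outer_surj w; rewrite !out_mulE mulgA.
Qed.
Fact out_mul1 : left_id out_one out_mul.
Proof. by move=> u; have [f ->] := outer_surj u; rewrite out_mulE mul1g. Qed.
Fact out_1mul : right_id out_one out_mul.
Proof. by move=> u; have [f ->] := outer_surj u; rewrite out_mulE mulg1. Qed.
Fact out_mulV : left_inverse out_one out_inv out_mul.
Proof.
by move=> u; have [f ->] := outer_surj u; rewrite out_invE out_mulE mulVg.
Qed.
Fact out_Vmul : right_inverse out_one out_inv out_mul.
Proof.
by move=> u; have [f ->] := outer_surj u; rewrite out_invE out_mulE mulgV.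
Qed.

HB.instance Definition _ :=
  isGroup.Build out out_mulA out_mul1 out_1mul out_mulV out_Vmul.

Lemma outerM f g : outer (f * g) = outer f * outer g.
Proof. by rewrite -out_mulE. Qed.

End Automorphisms.

(* The abelianization of the free group of rank n is realized as Z^n by the
   vector of exponent sums; ab_universal says that every homomorphism to an
   abelian group factors through it. *)
Section Abelianization.
Variable n : nat.
Local Open Scope ring_scope.

Definition ab_letter (a : letter n) : 'cV[int]_n :=
  if a.2 then delta_mx a.1 0 else - delta_mx a.1 0.

Definition ab (x : free_group n) : 'cV[int]_n :=
  \sum_(a <- fword x) ab_letter a.

Lemma abM x y : ab (x * y)%g = ab x + ab y.
Proof.
have abP a w : \sum_(b <- push a w) ab_letter b =
    ab_letter a + \sum_(b <- w) ab_letter b.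
  case: w => [|b w] /=; first by rewrite big_seq1 big_nil addr0.
  case: eqP => [->|_]; rewrite !big_cons //.
  by case: a => i []; rewrite /ab_letter /= ?addKr ?addNKr.
rewrite /ab [fword (x * y)%g]/=; elim: (fword x) => /= [|a s IHs].
  by rewrite big_nil add0r.
by rewrite abP IHs big_cons addrA.
Qed.

Lemma ab1 : ab 1%g = 0.
Proof. by rewrite /ab big_nil. Qed.

Lemma abV x : ab x^-1%g = - ab x.
Proof. by apply: (addrI (ab x)); rewrite -abM mulgV ab1 subrr. Qed.

Lemma ab_fgen i : ab (fgen i) = delta_mx i 0.
Proof. by rewrite /ab big_seq1. Qed.

Lemma ab_universal (V : zmodType) (f : free_group n -> V) :
  (forall x y, f (x * y)%g = f x + f y) ->
  forall x, f x = \sum_i f (fgen i) *~ ab x i 0.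
Proof.
move=> fM; have f1 : f 1%g = 0.
  by apply: (addrI (f 1%g)); rewrite -fM mulg1 addr0.
have fV x : f x^-1%g = - f x.
  by apply: (addrI (f x)); rewrite -fM mulgV f1 subrr.
have fg i : \sum_j f (fgen j) *~ ab (fgen i) j 0 = f (fgen i).
  rewrite (bigD1 i) //= ab_fgen mxE !eqxx big1 ?addr0 // => j /negPf ji.
  by rewrite mxE ji.
apply: free_group_ind => [|i x IHx|i x IHx].
- by rewrite f1 big1 // => i _; rewrite ab1 mxE.
- rewrite fM IHx -[X in X + _]fg -big_split /=.
  by apply: eq_bigr => j _; rewrite abM mxE mulrzDr.
- rewrite fM fV IHx -[X in - X + _]fg -sumrN -big_split /=.
  by apply: eq_bigr => j _; rewrite abM abV !mxE mulrzDr mulrNz.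
Qed.

(* The matrix, acting on columns, of the automorphism of Z^n induced by f. *)
Definition aut_mx (f : aut (free_group n)) : 'M[int]_n :=
  \matrix_(i, j) ab (f (fgen j)) i 0.

Lemma aut_mxE (f : aut (free_group n)) x : ab (f x) = aut_mx f *m ab x.
Proof.
have mxg i : aut_mx f *m ab (fgen i) = ab (f (fgen i)).
  by rewrite ab_fgen -colE; apply/colP => j; rewrite !mxE.
elim/free_group_ind: x => [|i x IHx|i x IHx].
- by rewrite aut1 ab1 mulmx0.
- by rewrite autM !abM mulmxDr IHx mxg.
- by rewrite autM autV !abM !abV mulmxDr mulmxN IHx mxg.
Qed.

Lemma aut_mx_unique (f : aut (free_group n)) (M : 'M[int]_n) :
  (forall x, ab (f x) = M *m ab x) -> M = aut_mx f.
Proof.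
move=> fM; apply/matrixP => i j.
by rewrite mxE fM ab_fgen -colE mxE.
Qed.

Lemma aut_mx1 : aut_mx 1%g = 1%:M.
Proof. by symmetry; apply: aut_mx_unique => x; rewrite mul1mx. Qed.

Lemma aut_mxM f g : aut_mx (f * g)%g = aut_mx f *m aut_mx g.
Proof.
symmetry; apply: aut_mx_unique => x.
by rewrite -mulmxA -!aut_mxE.
Qed.

Lemma aut_mx_inner f : inner f -> aut_mx f = 1%:M.
Proof.
case=> c fE; symmetry; apply: aut_mx_unique => x.
by rewrite fE !abM abV addrAC subrr add0r mul1mx.
Qed.

Definition out_mx (u : out (free_group n)) : 'M[int]_n :=
  aut_mx (out_repr u).

Lemma out_mxE f : out_mx (outer f) = aut_mx f.
Proof.
have := aut_mx_inner (repr_outer f); rewrite aut_mxM => fE.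
rewrite /out_mx; set g := out_repr _ in fE *.
by rewrite -[LHS]mulmx1 -fE mulmxA -aut_mxM mulgV aut_mx1 mul1mx.
Qed.

Lemma out_mx1 : out_mx 1%g = 1%:M.
Proof. by rewrite [1%g]/(outer 1%g) out_mxE aut_mx1. Qed.

Lemma out_mxM u v : out_mx (u * v)%g = out_mx u *m out_mx v.
Proof.
have [f ->] := outer_surj u; have [g ->] := outer_surj v.
by rewrite -outerM !out_mxE aut_mxM.
Qed.

Lemma out_mx_unit u : out_mx u \in unitmx.
Proof.
suff /mulmx1_unit[] : out_mx u *m out_mx u^-1%g = 1%:M by [].
by rewrite -out_mxM mulgV out_mx1.
Qed.

Definition SLZ : set 'M[int]_n := [set M | \det M = 1].

Definition SOut : set (out (free_group n)) := out_mx @^-1` SLZ.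

Lemma SOut_group_closed : group_closed (mem SOut).
Proof.
split; first by rewrite inE /SOut /SLZ /= out_mx1 det1.
move=> u v; rewrite !inE /SOut /SLZ /= => du dv.
rewrite out_mxM det_mulmx du mul1r.
have := congr1 determinant (out_mx1); rewrite -(mulgV v) out_mxM det_mulmx dv.
by rewrite mul1r det1.
Qed.

End Abelianization.

(* Subgroups of an arbitrary group G, and the index of H in K, which is the
   cardinality of the set of right cosets of H by the elements of K. *)
Section Index.
Local Open Scope classical_set_scope.
Local Open Scope card_scope.
Variable G : groupType.
Implicit Types (H K : set G).

Definition subgroup H K : Prop := group_closed (mem H) /\ H `<=` K.

Definition coset_of_set H (x : G) : set G := [set h * x | h in H].

Definition coset_set H K : set (set G) := coset_of_set H @` K.

Definition has_index H K (m : nat) : Prop := coset_set H K #= `I_m.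

(* m is the minimal index in K of the subgroups of K that satisfy P; these may
   also be of infinite index. *)
Definition minimal_index (P : set G -> Prop) K (m : nat) : Prop :=
  (exists H, [/\ subgroup H K, P H & has_index H K m]) /\
  (forall H, subgroup H K -> P H -> `I_m #<= coset_set H K).

End Index.

Section SpecialLinear.
Variables (n : nat) (R : finComUnitRingType).

Definition SL : {set {'GL_n[R]}} := [set u | (\det (GLval u) == 1)%R].

Fact SL_group_set : group_set SL.
Proof.
apply/group_setP; split; first by rewrite inE GL_1E det1.
move=> u v; rewrite !inE GL_MxE det_mulmx => /eqP-> /eqP->.
by rewrite mulr1.
Qed.

Canonical SL_group : {group {'GL_n[R]}} := Group SL_group_set.

Definition PSL : {set coset_of 'Z(SL)} := SL / 'Z(SL).
Canonical PSL_group : {group coset_of 'Z(SL)} := Eval hnf in [group of PSL].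

End SpecialLinear.

Arguments SOut n : clear implicits.
Arguments SL n R : clear implicits.
Arguments PSL n R : clear implicits.

(* Main.v *)
(* Lower bound.  By Nielsen's theorem the automorphisms of determinant one of
   F_4 are products of transvections, so it suffices to show that every
   homomorphism from this group to S_7 kills the transvections.  The signed
   permutation x_0 -> x_1 -> x_2 -> x_3 -> x_0^-1 has order 8 and S_7 has no
   element of order 8, so its fourth power, which inverts every generator, is
   killed.  Modulo it, two sign changes and two double transpositions generate
   an elementary abelian group of rank 4, whereas those in S_7 have rank at most
   3; hence some product of them is killed.  If it permutes the generators
   non-trivially, a commutator relation kills a transvection, hence all of
   them.  Otherwise all even sign changes are killed, so the transvections have
   order two modulo the kernel and no longer depend on sides; four commuting
   ones give again a nontrivial product in the kernel, a double commutator of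
   which is a transvection.

   Eight points.  GL_4(2) acts on the alternating forms; the 28 nondegenerate
   ones are the pairwise differences of eight forms, which GL_4(2) permutes up
   to translation.  Comparing orders identifies GL_4(2) with A_8. *)

From mathcomp Require Import all_boot all_algebra all_fingroup all_solvable.
From mathcomp Require Import boolp classical_sets functions cardinality.
From mathcomp Require Import zify.
Require Import Defs.

Set Implicit Arguments.
Unset Strict Implicit.
Unset Printing Implicit Defensive.

Import GRing.Theory.
Local Open Scope group_scope.

Definition word_eval (A : Type) (G : groupType) (V : A -> G) (s : seq A) : G :=
  foldr (fun a x => V a * x) 1 s.

Lemma word_eval_cat (A : Type) (G : groupType) (V : A -> G) s t :
  word_eval V (s ++ t) = word_eval V s * word_eval V t.
Proof. by elim: s => /= [|a s ->]; rewrite ?mul1g ?mulgA. Qed.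

(** * Cancellation in free groups *)

Section FreeGroupWords.
Variable n : nat.
Implicit Types (u v : free_group n) (a b c : letter n) (s t p q : seq (letter n)).

Lemma inv_word_cat s t : inv_word (s ++ t) = inv_word t ++ inv_word s.
Proof. by rewrite /inv_word map_cat rev_cat. Qed.

Lemma size_inv_word s : size (inv_word s) = size s.
Proof. by rewrite size_rev size_map. Qed.

Lemma fword_inv u : fword u^-1 = inv_word (fword u).
Proof. by []. Qed.

Lemma linv_neq a : linv a != a.
Proof. by case: a => i b; rewrite /linv xpair_eqE /= eqxx; case: b. Qed.

Lemma reduced_cat s t : reduced (s ++ t) -> reduced s /\ reduced t.
Proof. by rewrite /reduced => /cat_sorted2[]. Qed.

Lemma reduced_glue s q t :
  q != [::] -> reduced (s ++ q) -> reduced (q ++ t) -> reduced (s ++ q ++ t).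
Proof.
rewrite /reduced; case: q => // a q _; case: s => [|b s] //=.
rewrite !cat_path /= => /and3P[-> -> _] /=.
by rewrite cat_path.
Qed.

Lemma act_word_cat s t : reduced (s ++ t) -> act_word s t = s ++ t.
Proof.
move=> st_red; rewrite -[RHS]act_word_nil // -[t in LHS]act_word_nil; last first.
  by case: (reduced_cat st_red).
by rewrite /act_word -foldr_cat.
Qed.

Lemma reduced_no_fold s a t : reduced (s ++ linv a :: a :: t) -> False.
Proof. by case/reduced_cat=> _ /=; rewrite linvK eqxx. Qed.

(** Cancellation starts at the junction, hence the induction on the last letter of [s]; the suffix
    [p] collects everything that cancels. *)
Lemma act_word_cancel s t : reduced s -> reduced t ->
  exists x p y, [/\ s = x ++ p, t = inv_word p ++ y,
    act_word s t = x ++ y & reduced (x ++ y)].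
Proof.
elim/last_ind: s t => [|s a IHs] t sr tr; first by exists [::], [::], t.
have [sr' _] : reduced s /\ reduced [:: a] by apply: reduced_cat; rewrite cats1.
rewrite /act_word foldr_rcons -/(act_word _ _).
case: t tr => [|b t] tr /=.
  exists (rcons s a), [::], [::]; rewrite !cats0 act_word_cat cats1 //.
case: eqP => [bE|/eqP bN].
  have [x [p [y [-> -> -> xyr]]]] := IHs t sr' (reduced_tail tr).
  by exists x, (rcons p a), y; rewrite rcons_cat bE /inv_word map_rcons rev_rcons.
have r : reduced (s ++ [:: a] ++ b :: t).
  by apply: reduced_glue => //; [rewrite cats1 | rewrite /= bN].
by exists (rcons s a), [::], (b :: t); rewrite cats0 cat_rcons act_word_cat.
Qed.

Lemma mul_cancel u v : exists x p y, [/\ fword u = x ++ p,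
  fword v = inv_word p ++ y, fword (u * v) = x ++ y & reduced (x ++ y)].
Proof. by apply: act_word_cancel; [apply: (valP u) | apply: (valP v)]. Qed.

Definition len u := size (fword u).

Lemma lenV u : len u^-1 = len u.
Proof. exact: size_inv_word. Qed.

Lemma len_eq0 u : (len u == 0%N) = (u == 1).
Proof. by rewrite /len size_eq0. Qed.

(** If at least half of [u] cancelled in [u * u], letters in mirror positions would be mutually
    inverse. For odd length the middle letter would be its own inverse; for even length the two
    middle letters would contradict reducedness. *)
Lemma len_sqr u : u != 1 -> len u < len (u * u).
Proof.
rewrite -len_eq0 /len => u_neq0.
have [x [p [y [uE uE' -> _]]]] := mul_cancel u u.
have sx : size (fword u) = (size x + size p)%N by rewrite uE size_cat.
have sy : size (fword u) = (size p + size y)%N.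
  by rewrite uE' size_cat size_inv_word.
rewrite size_cat; case: (ltnP (size p) (size x)) => [|pbig]; first by lia.
exfalso; set m := size (fword u) in u_neq0 sx sy.
have a0 : letter n by move: u_neq0; rewrite /m; case: (fword u) => // z.
have flip i : i < size p -> nth a0 (fword u) i = linv (nth a0 (fword u) (m.-1 - i)).
  move=> ip; rewrite {1}uE' nth_cat size_inv_word ip.
  rewrite nth_rev ?size_map // (nth_map a0); last by lia.
  by rewrite uE nth_cat ifF; [congr (linv (nth _ _ _)); lia | lia].
have := flip m.-1./2; case: (boolP (odd m)) => mo.
  have -> : (m.-1 - m.-1./2)%N = m.-1./2 by lia.
  by move=> h; case/eqP: (linv_neq (nth a0 (fword u) m.-1./2)); rewrite -h //; lia.
have -> : (m.-1 - m.-1./2)%N = m.-1./2.+1 by lia.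
move=> h; have /(sortedP a0) /(_ m.-1./2) := valP u; rewrite h; last by lia.
by rewrite linvK eqxx => /(_ _)/negP[] //; rewrite -/m; lia.
Qed.

Definition code a : nat := (a.1 * 2 + a.2)%N.
(** Read in base [2n], so that words of equal length are compared lexicographically through natural
    numbers. *)
Definition numeral s : nat := foldl (fun N a => N * n.*2 + code a)%N 0%N s.

Lemma code_lt a : code a < n.*2.
Proof. by rewrite /code; have := ltn_ord a.1; case: a.2 => /=; lia. Qed.

Lemma code_inj : injective code.
Proof.
move=> [i b] [j c]; rewrite /code /= => ijE.
have -> : b = c by move: ijE; case: b; case: c; lia.
by congr (_, _); apply: val_inj => /=; move: ijE; case: b; case: c; lia.
Qed.

Lemma numeral_rcons s a : numeral (rcons s a) = (numeral s * n.*2 + code a)%N.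
Proof. by rewrite /numeral foldl_rcons. Qed.

Lemma numeral_inj s t : size s = size t -> numeral s = numeral t -> s = t.
Proof.
elim/last_ind: s t => [|s a IHs] t; first by case: t.
elim/last_ind: t => [|t b _]; rewrite ?size_rcons // => -[st].
rewrite !numeral_rcons => nE.
have := code_lt a; have := code_lt b => bl al.
have ab : code a = code b.
  have := congr1 (fun N => N %% n.*2) nE.
  by rewrite !modnMDl !modn_small.
rewrite (code_inj ab) (IHs t) //; move: nE; rewrite ab => /addIn /eqP.
by rewrite eqn_pmul2r => [/eqP//|]; lia.
Qed.

Lemma numeral_cat_lt s t q : size s = size t -> numeral s < numeral t ->
  numeral (s ++ q) < numeral (t ++ q).
Proof.
move=> st lt_st; elim/last_ind: q => [|q a IHq]; first by rewrite !cats0.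
rewrite -!rcons_cat !numeral_rcons ltn_add2r ltn_pmul2r //.
by have := code_lt a; lia.
Qed.

Definition half u := take (uphalf (len u)) (fword u).
(* Ties between words of equal length are broken by their two initial halves;
   this is what makes the second kind of Nielsen reduction terminate. *)
Definition weight u : nat := (numeral (half u) + numeral (half u^-1))%N.

Lemma weightV u : weight u^-1 = weight u.
Proof. by rewrite /weight invgK addnC. Qed.

(** As [p] and [q] make up at most half of their words, the initial halves of the inverses lie
    within the inverse of [y] and agree; those of [u] and [v] are [p] and [q] followed by the same
    letters. *)
Lemma weight_lt u v p q y : fword u = p ++ y -> fword v = q ++ y ->
  size p = size q -> size p <= size y -> numeral p < numeral q ->
  weight u < weight v.
Proof.
move=> uE vE pq py lt_pq.
have lu : len u = (size p + size y)%N by rewrite /len uE size_cat.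
have lv : len v = len u by rewrite lu /len vE size_cat pq.
have hV : half u^-1 = half v^-1.
  rewrite /half !lenV lv !fword_inv uE vE !inv_word_cat !take_cat size_inv_word.
  case: ltnP => // yh; have -> : (uphalf (len u) - size y)%N = 0%N by lia.
  by rewrite !take0.
rewrite /weight hV ltn_add2r /half lv uE vE !take_cat -pq.
rewrite !ifF; try by lia.
exact: numeral_cat_lt.
Qed.

(* The number of letters cancelled between u and v is half of this. *)
Definition cancel2 u v := (len u + len v - len (u * v)%g)%N.

Definition lt a : free_group n := @FreeGroup n [:: a] isT.

Lemma ltV a : lt (linv a) = (lt a)^-1.
Proof. exact: val_inj. Qed.

Lemma ltT (i : 'I_n) : lt (i, true) = fgen i.
Proof. exact: val_inj. Qed.

Lemma word_eval_lt u : u = word_eval lt (fword u).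
Proof.
case: u => [s sr]; apply: val_inj; elim: s sr => //= a s IHs sr.
rewrite -IHs ?(reduced_tail sr) //=; case: s sr {IHs} => //= b s.
by case/andP=> /negPf->.
Qed.

(** * Products of Nielsen-reduced families *)

Section NielsenReduced.
Variable V : letter n -> free_group n.
Hypothesis V_neq1 : forall a, V a != 1.
Hypothesis VN1 : forall a b, b != linv a ->
  len (V a) <= len (V a * V b) /\ len (V b) <= len (V a * V b).
Hypothesis VN2 : forall a b c, b != linv a -> c != linv b ->
  cancel2 (V a) (V b) + cancel2 (V b) (V c) < (len (V b)).*2.

(* Some initial segment of the last factor V b survives in the product, and it
   is longer than what any further factor on the left can cancel. *)
Let sticks b u := exists q t r, [/\ fword u = q ++ t, fword (V b) = q ++ r &
  forall a, b != linv a -> cancel2 (V a) (V b) < (size q).*2].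

(** By the property of [q], the factor [V a] cancels only a proper initial segment of it, so a
    nonempty [q'] still joins the remainder [x] of [V a] to the rest. [VN2] makes [x] long enough to
    be the next sticking segment. *)
Let sticks_step a b u : b != linv a -> sticks b u ->
  [/\ sticks a (V a * u), ~~ odd (cancel2 (V a) (V b)) &
    (len (V a * u)%g + cancel2 (V a) (V b) = len (V a) + len u)%N].
Proof.
move=> ba [q [t [r [uE VbE qmin]]]]; have := qmin a ba.
have [x [p [y [VaE VbE' ME Mr]]]] := mul_cancel (V a) (V b).
have ccE : cancel2 (V a) (V b) = (size p).*2.
  by rewrite /cancel2 /len VaE VbE' ME !size_cat size_inv_word; lia.
rewrite ccE ltn_double => pq.
have [q' qE] : exists q', q = inv_word p ++ q'.
  exists (drop (size p) q); rewrite -[LHS](cat_take_drop (size p)); congr (_ ++ _).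
  have := congr1 (take (size p)) VbE'; rewrite VbE !take_cat pq size_inv_word.
  by rewrite ltnn subnn take0 cats0.
have q'0 : q' != [::].
  by apply: contraTneq pq => q'0; rewrite qE q'0 cats0 size_inv_word ltnn.
have yE : y = q' ++ r.
  by move: VbE'; rewrite VbE qE -catA => /eqP; rewrite eqseq_cat // eqxx => /eqP<-.
have xq'tr : reduced (x ++ q' ++ t).
  apply: reduced_glue => //.
    by move: Mr; rewrite yE catA => /reduced_cat[].
  have := valP u; rewrite /= uE qE -catA; by case/reduced_cat.
have VuE : fword (V a * u) = x ++ q' ++ t.
  have -> : fword (V a * u) = act_word (x ++ p) (fword u) by rewrite -VaE.
  rewrite uE qE -[RHS]act_word_cat // /act_word foldr_cat -!catA; congr foldr.
  rewrite -/(act_word _ _) -[inv_word p ++ _]act_word_cat; last first.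
    by have := valP u; rewrite /= uE qE -catA.
  rewrite -[p in act_word p]inv_wordK -act_wordA ?inv_word_act //.
  by case: (reduced_cat xq'tr).
have szE : len (V a) = (size x + size p)%N by rewrite /len VaE size_cat.
split; [|by rewrite odd_double |]; last first.
  by rewrite szE /len VuE uE qE !size_cat size_inv_word; lia.
exists x, (q' ++ t), p; split=> // c ac.
by have := VN2 ac ba; rewrite ccE szE; lia.
Qed.

Let sticks_word a s : reduced (a :: s) ->
  [/\ sticks a (word_eval V (a :: s)), len (V a) <= len (word_eval V (a :: s)) &
      s != [::] -> 1 < len (word_eval V (a :: s))].
Proof.
have V_gt0 c : 0 < len (V c) by rewrite lt0n len_eq0.
elim: s a => [|b s IHs] a sr.
  rewrite /= mulg1; split=> //; exists (fword (V a)), [::], [::].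
  rewrite cats0; split=> // c ac; have [] := VN1 ac.
  by have := V_gt0 a; have := V_gt0 c; rewrite /cancel2 -/(len (V a)); lia.
have ba : b != linv a by case/andP: sr.
have [stk leb _] := IHs b (reduced_tail sr).
have [stk' cE lenE] := sticks_step ba stk; have [l1 l2] := VN1 ba.
rewrite -[word_eval V [:: a, b & s]]/(V a * word_eval V (b :: s)).
have := V_gt0 a; have := V_gt0 b.
(* Length one would force two factors of length one with a product of length one, so [cancel2] would
   be 1; its parity excludes this. *)
by split=> //; move: cE lenE leb; rewrite /cancel2; lia.
Qed.

(** Meant for the word that expresses a generator in a reduced basis: such a word can only be a
    single letter. *)
Lemma nielsen_reduced_len1 s :
  reduced s -> len (word_eval V s) = 1%N -> exists a, s = [:: a].
Proof.
case: s => // a [|b s] sr; first by exists a.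
by have [_ _] := sticks_word sr; case: (len _) => [|[]] // /(_ isT).
Qed.

End NielsenReduced.
End FreeGroupWords.

(** * Nielsen reduction *)

Section Nielsen.
Variable n : nat.
Implicit Types (u v : free_group n) (a b c : letter n).

Definition extend_letter (h : 'I_n -> free_group n) a :=
  if a.2 then h a.1 else (h a.1)^-1.

Definition extend (h : 'I_n -> free_group n) u :=
  word_eval (extend_letter h) (fword u).

Lemma extendM h : {morph extend h : u v / u * v}.
Proof.
have pushE a s : word_eval (extend_letter h) (push a s) =
    extend_letter h a * word_eval (extend_letter h) s.
  case: s => //= b s; case: eqP => //= ->.
  rewrite mulgA; case: a => i []; rewrite /extend_letter /=.
    by rewrite mulgV mul1g.
  by rewrite mulVg mul1g.
move=> u v; rewrite /extend [fword (u * v)]/=.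
by elim: (fword u) => /= [|a s IHs]; rewrite ?mul1g // pushE IHs mulgA.
Qed.

Lemma extendV h u : extend h u^-1 = (extend h u)^-1.
Proof.
have h1 : extend h 1 = 1 by [].
by apply: (mulgI (extend h u)); rewrite -extendM !mulgV h1.
Qed.

Lemma lt_false (i : 'I_n) : lt (i, false) = (fgen i)^-1.
Proof. exact: val_inj. Qed.

Lemma extend_lt h a : extend h (lt a) = extend_letter h a.
Proof. by rewrite /extend /= mulg1. Qed.

Lemma extend_gen h i : extend h (fgen i) = h i.
Proof. by rewrite -ltT extend_lt. Qed.

Lemma hom_eq (f g : free_group n -> free_group n) :
  {morph f : u v / u * v} -> {morph g : u v / u * v} ->
  (forall i, f (fgen i) = g (fgen i)) -> f =1 g.
Proof.
move=> fM gM fg.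
have h1 (h : free_group n -> free_group n) : {morph h : u v / u * v} -> h 1 = 1.
  by move=> hM; apply: (mulgI (h 1)); rewrite -hM !mulg1.
have hV (h : free_group n -> free_group n) u :
    {morph h : u v / u * v} -> h u^-1 = (h u)^-1.
  by move=> hM; apply: (mulgI (h u)); rewrite -hM !mulgV h1.
elim/free_group_ind => [|i x IHx|i x IHx]; first by rewrite !h1.
  by rewrite fM gM fg IHx.
by rewrite fM gM !hV // fg IHx.
Qed.

(* The pair of letters g acts by g.1 |-> g.1 g.2 and fixes the other
   generators, so that a single family covers left and right transvections
   and their inverses; a degenerate pair acts trivially. *)
Definition transv_gen (g : letter n * letter n) (i : 'I_n) : free_group n :=
  if (i == g.1.1) && (g.1.1 != g.2.1) then
    if g.1.2 then lt g.1 * lt g.2 else (lt g.1 * lt g.2)^-1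
  else fgen i.

Lemma transv_lt a b : a.1 != b.1 ->
  extend (transv_gen (a, b)) (lt a) = lt a * lt b.
Proof.
move=> ab; rewrite extend_lt /extend_letter /transv_gen eqxx ab /=.
by case: a.2; rewrite ?invgK.
Qed.

Lemma transv_fix g c : c.1 != g.1.1 -> extend (transv_gen g) (lt c) = lt c.
Proof.
move=> /negPf ca; rewrite extend_lt /extend_letter /transv_gen ca /=.
case: c {ca} => i b /=; rewrite -ltT; case: b => //.
by rewrite -ltV.
Qed.

Lemma transv_degenerate a b : a.1 = b.1 -> extend (transv_gen (a, b)) =1 id.
Proof.
move=> ab; apply: hom_eq => [||i] //; first exact: extendM.
by rewrite extend_gen /transv_gen /= ab eqxx andbF.
Qed.

Lemma transvK a b :
  cancel (extend (transv_gen (a, b))) (extend (transv_gen (a, linv b))).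
Proof.
have [ab|ab] := eqVneq a.1 b.1.
  by move=> u; rewrite !transv_degenerate.
move=> u; apply: (hom_eq (f := extend _ \o extend _) (g := id)) => //.
  by move=> x y; rewrite /= !extendM.
have fixb c : c.1 != a.1 ->
    extend (transv_gen (a, linv b)) (extend (transv_gen (a, b)) (lt c)) = lt c.
  by move=> ca; rewrite !transv_fix.
move=> i /=; have [ia|ia] := eqVneq i a.1; last by rewrite -ltT fixb.
have Ka : extend (transv_gen (a, linv b)) (extend (transv_gen (a, b)) (lt a)) =
    lt a.
  rewrite transv_lt // extendM transv_lt // transv_fix 1?eq_sym //.
  by rewrite ltV mulgVK.
case: a ab fixb Ka ia => j [] /= ab fixb Ka ->; first by rewrite -ltT.
by apply: invg_inj; rewrite -!extendV -lt_false.
Qed.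

Fact transv_is_aut g : is_aut (extend (transv_gen g)).
Proof.
case: g => a b; split; last exact: extendM.
exists (extend (transv_gen (a, linv b))); first exact: transvK.
by move=> u; rewrite -[b in (a, b)]linvK transvK.
Qed.

Definition transv g : aut (free_group n) := Aut (transv_is_aut g).
Definition tprod (s : seq (letter n * letter n)) := word_eval transv s.

Lemma aut_lt_eq (f g : aut (free_group n)) :
  (forall i, f (fgen i) = g (fgen i)) -> f = g.
Proof. by move=> fg; apply/aut_eq/hom_eq => //; apply: autM. Qed.

Lemma tprod_cat s t : tprod (s ++ t) = tprod s * tprod t.
Proof. exact: word_eval_cat. Qed.

Lemma tprod1 g : tprod [:: g] = transv g.
Proof. exact: mulg1. Qed.

Definition winv (s : seq (letter n * letter n)) :=
  rev [seq (g.1, linv g.2) | g <- s].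

Lemma tprod_winv s : tprod (winv s) = (tprod s)^-1.
Proof.
elim: s => [|[a b] s IHs]; first by rewrite /= invg1.
rewrite /winv /= rev_cons -cats1 tprod_cat -/(winv s) IHs tprod1.
rewrite [RHS]invgM; congr (_ * _); apply: (mulIg (transv (a, b))).
by rewrite mulVg; apply: aut_eq => u; rewrite /= transvK.
Qed.

(** * Descent by transvections on total length and total weight *)

Section Descent.
Implicit Type f : aut (free_group n).

Let im f a : free_group n := f (lt a).

Let total (F : free_group n -> nat) f := (\sum_i F (f (fgen i)))%N.

(** Multiplication is composition, so a transvection on the right changes the basis [f (fgen i)] in
    one place. Invariance of [F] under inversion covers the case of an inverse generator [a]. *)
Let total_transv F f a b : (forall u, F u^-1 = F u) -> a.1 != b.1 ->
  (total F (f * transv (a, b))%g + F (im f a) =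
   total F f + F (im f a * im f b)%g)%N.
Proof.
move=> FV ab; rewrite /total (bigD1 a.1) // [in RHS](bigD1 a.1) //=.
rewrite addnAC [in RHS]addnAC; congr (_ + _)%N; last first.
  by apply: eq_bigr => i ia; rewrite -!ltT /= transv_fix.
rewrite addnC; congr (_ + _)%N.
  by rewrite /im; case: a {ab} => i [] /=; rewrite ?ltT // lt_false autV FV.
rewrite /im -autM -transv_lt //.
by case: a {ab} => i []; rewrite ?ltT // lt_false extendV autV FV.
Qed.

Let permutes_gens f := forall i, exists a, f (lt a) = fgen i.

(** Nielsen's conditions are stated for letters of distinct generators, the pairs that transvections
    can combine; repeated letters are handled by [len_sqr]. *)
Let N1 f := forall a b, a.1 != b.1 -> len (im f a) <= len (im f a * im f b).
Let N2 f := forall a b c, a.1 != b.1 -> b.1 != c.1 ->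
  cancel2 (im f a) (im f b) + cancel2 (im f b) (im f c) <
  (len (im f b)).*2.

Let f_lt_neq1 f a : im f a != 1.
Proof.
apply/eqP => fa; suff: lt a = 1 by [].
by apply: (can_inj (aut_invK f)); rewrite aut1.
Qed.

Let f_ltV f a : im f (linv a) = (im f a)^-1.
Proof. by rewrite /im ltV autV. Qed.

Let neq_linv a b : b != linv a -> (a.1 != b.1) || (a == b).
Proof.
case: a b => i x [j y]; rewrite /linv /=; have [<-|] //= := eqVneq i j.
by case: x y => [] [] //=; rewrite eqxx.
Qed.

Let N1r f a b : N1 f -> a.1 != b.1 -> len (im f b) <= len (im f a * im f b).
Proof.
move=> f1 ab; have := f1 (linv b) (linv a); rewrite /= eq_sym => /(_ ab).
by rewrite !f_ltV -invgM !lenV.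
Qed.

Let cancel2_sqr u : u != 1 -> cancel2 u u < len u.
Proof.
move=> u1; have := len_sqr u1; move: u1; rewrite -len_eq0 /cancel2; lia.
Qed.

Let cancel2_le f a b : N1 f -> a.1 != b.1 ->
  cancel2 (im f a) (im f b) <= len (im f a) /\
  cancel2 (im f a) (im f b) <= len (im f b).
Proof.
by move=> f1 ab; have := N1r f1 ab; have := f1 a b ab; rewrite /cancel2; lia.
Qed.

(** The preimage of a generator expresses this element of length one through the images of the
    letters, which are Nielsen reduced; hence the preimage is a letter. *)
Let reduced_permutes f : N1 f -> N2 f -> permutes_gens f.
Proof.
move=> f1 f2 i; pose x := (f^-1) (fgen i).
have fx : f x = fgen i by apply: (aut_Kinv f).
have fE : f x = word_eval (im f) (fword x).
  rewrite {1}[x]word_eval_lt; elim: (fword x) => [|a s IHs]; first exact: aut1.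
  by rewrite /= autM IHs.
have [a xE] : exists a, fword x = [:: a].
  apply: (nielsen_reduced_len1 (V := im f)) => //.
  - move=> a b ba; have /orP[ab|/eqP<-] := neq_linv ba.
      by split; [apply: f1 | apply: N1r].
    by have := len_sqr (f_lt_neq1 f a); lia.
  - move=> a b c ba cb; have /orP[ab|/eqP abE] := neq_linv ba;
      have /orP[bc|/eqP bcE] := neq_linv cb.
    + exact: f2.
    + have [_ h1] := cancel2_le f1 ab.
      by have := cancel2_sqr (f_lt_neq1 f b); rewrite -bcE; lia.
    + have [h1 _] := cancel2_le f1 bc.
      by have := cancel2_sqr (f_lt_neq1 f b); rewrite abE; lia.
    + have := cancel2_sqr (f_lt_neq1 f b); rewrite -bcE abE; lia.
  - exact: (valP x).
  - by rewrite -fE fx.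
by exists a; rewrite -fx; congr (f _); apply: val_inj.
Qed.

(** By [N1] each neighbour cancels exactly half of [f b], so [f b] is [p'^-1 q], [f a] is [x p'] and
    [f c] is [q^-1 z]. Replacing [f c] by [p'^-1 z], or [f a] by [x q], keeps the lengths; comparing
    the numerals of [p'^-1] and [q^-1] tells which replacement lowers the weight. *)
Let reduce_weight f a b c : N1 f -> a.1 != b.1 -> b.1 != c.1 ->
  (len (im f b)).*2 <=
    cancel2 (im f a) (im f b) + cancel2 (im f b) (im f c) ->
  exists g, total (@len n) (f * transv g) = total (@len n) f /\
            total (@weight n) (f * transv g) < total (@weight n) f.
Proof.
move=> f1 ab bc cc.
have [ha1 ha2] := cancel2_le f1 ab; have [hb1 hb2] := cancel2_le f1 bc.
have b_neq0 : len (im f b) != 0%N by rewrite len_eq0.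
have lab : len (im f a * im f b) = len (im f a).
  by have := N1r f1 ab; have := f1 a b ab;
    move: cc ha1 ha2 hb1 hb2; rewrite /cancel2; lia.
have lbc : len (im f b * im f c) = len (im f c).
  by have := N1r f1 bc; have := f1 b c bc;
    move: cc ha1 ha2 hb1 hb2; rewrite /cancel2; lia.
have eab : cancel2 (im f a) (im f b) = len (im f b) by lia.
have ebc : cancel2 (im f b) (im f c) = len (im f b) by lia.
have [x [p' [y [aE bE abE _]]]] := mul_cancel (im f a) (im f b).
have [x' [q [z [bE' cE bcE _]]]] := mul_cancel (im f b) (im f c).
have := congr1 size bE; have := congr1 size bE'.
rewrite !size_cat size_inv_word => sb' sb''.
have sp : size p' = size q.
  move: eab ebc; rewrite /cancel2 /len abE bcE aE cE.
  by rewrite !size_cat size_inv_word; lia.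
have sb : size (fword (im f b)) = (size p' + size q)%N.
  by move: eab; rewrite /cancel2 /len abE aE !size_cat; lia.
have [yE x'E] : x' = inv_word p' /\ y = q.
  have /eqP := bE'; rewrite bE eqseq_cat; last first.
    by apply: (@addIn (size q)); rewrite size_inv_word -[RHS]sb' -[LHS]sb.
  by case/andP=> /eqP-> /eqP->.
subst x' y.
have pz : size q <= size z.
  by move: hb2; rewrite ebc /len sb cE size_cat size_inv_word addnC leq_add2l sp.
have px : size p' <= size x.
  by move: ha1; rewrite eab /len sb aE size_cat addnC leq_add2r -sp.
have [pq|pq|pqE] := ltngtP (numeral (inv_word p')) (numeral (inv_word q)).
- exists (linv c, linv b); have cb : (linv c).1 != (linv b).1 by rewrite eq_sym.
  have := total_transv f (@lenV n) cb; rewrite !f_ltV -invgM !lenV lbc.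
  have := total_transv f (@weightV n) cb; rewrite !f_ltV -invgM !weightV.
  have szE : size (inv_word p') = size (inv_word q) by rewrite !size_inv_word.
  have pz' : size (inv_word p') <= size z by rewrite szE size_inv_word.
  have lt_w := weight_lt bcE cE szE pz' pq.
  move=> eqw eql; split; first by apply: (addIn eql).
  by rewrite -(ltn_add2r (weight (im f c))) eqw ltn_add2l.
- exists (a, b).
  have := total_transv f (@lenV n) ab; rewrite lab.
  have := total_transv f (@weightV n) ab.
  rewrite -(weightV (_ * _)) -(weightV (im f a)).
  have lt_w : weight (im f a * im f b)^-1 < weight (im f a)^-1.
    apply: (@weight_lt _ _ _ (inv_word q) (inv_word p') (inv_word x)) => //.
    + by rewrite fword_inv abE inv_word_cat.
    + by rewrite fword_inv aE inv_word_cat.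
    + by rewrite !size_inv_word.
    + by rewrite !size_inv_word -sp.
  move=> eqw eql; split; first by apply: (addIn eql).
  by rewrite -(ltn_add2r (weight (im f a)^-1)) eqw ltn_add2l.
(* Equal halves would make [f b] the word [q^-1 q], which is reduced only if it is empty. *)
- have := numeral_inj _ pqE; rewrite !size_inv_word => /(_ sp) pqE'.
  case/eqP: (f_lt_neq1 f b); apply: val_inj; rewrite /= bE.
  have := valP (im f b); rewrite /= bE pqE'; case: (q) => // e q'.
  by rewrite /inv_word /= rev_cons cat_rcons => /reduced_no_fold.
Qed.

(** The descent is lexicographic: a violation of [N1] lowers the total length, a violation of [N2]
    keeps it and lowers the total weight. *)
Theorem nielsen_descent f : exists s, permutes_gens (f * tprod s).
Proof.
have [L] := ubnP (total (@len n) f); elim: L f => // L IHL f.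
have [W] := ubnP (total (@weight n) f); elim: W f => // W IHW f fW fL.
have [f1|] := pselect (N1 f); last first.
  move/existsNP => [a /existsNP[b /not_implyP[ab /negP]]]; rewrite -ltnNge => lt_ab.
  have [|s Hs] := IHL (f * transv (a, b)).
    by have := total_transv f (@lenV n) ab; lia.
  by exists ((a, b) :: s); rewrite /= mulgA.
have [f2|] := pselect (N2 f).
  by exists [::]; rewrite /= mulg1; apply: reduced_permutes.
move/existsNP => [a /existsNP[b /existsNP[c /not_implyP[ab /not_implyP[bc /negP]]]]].
rewrite -leqNgt => /(reduce_weight f1 ab bc) [g [lenE weightE]].
have [||s Hs] := IHW (f * transv g); try lia.
by exists (g :: s); rewrite /= mulgA.
Qed.

End Descent.
End Nielsen.

(** * Automorphisms of determinant one *)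

Section SpecialAut.
Variable n : nat.
Implicit Types (f m : aut (free_group n.+1)) (a b c : letter n.+1).

Lemma ab_lt a : ab (lt a) = ab_letter a.
Proof. by rewrite /ab big_seq1. Qed.

(** For distinct generators the matrix is the identity with one further entry 1 or -1 off the
    diagonal, hence triangular, if need be after transposition. *)
Lemma det_transv (g : letter n.+1 * letter n.+1) : (\det (aut_mx (transv g)) = 1)%R.
Proof.
case: g => a b; have [ab|ab] := eqVneq a.1 b.1.
  suff -> : transv (a, b) = 1 by rewrite aut_mx1 det1.
  by apply: aut_eq => x; apply: transv_degenerate.
have tE k l : aut_mx (transv (a, b)) k l =
    ((k == l)%:R + (if (l == a.1) && (k == b.1) then
       if a.2 == b.2 then 1 else - 1 else 0))%R.
  rewrite mxE /= extend_gen /transv_gen /= ab andbT.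
  case: eqP => [->|_] /=; last by rewrite ab_fgen mxE eqxx andbT addr0.
  case: a b {ab} => i x [j y] /=.
  case: x y => [] [] /=; rewrite ?abV abM !ab_lt /ab_letter /= !mxE !eqxx !andbT;
    by case: (k == i); case: (k == j); rewrite ?mulr0n ?mulr1n; lia.
have diag k : aut_mx (transv (a, b)) k k = 1%R.
  rewrite tE eqxx; case: andP => [[/eqP ka /eqP kb]|]; last by rewrite addr0.
  by case/eqP: ab; rewrite -ka -kb.
case: (leqP a.1 b.1) => [le_ab|lt_ba].
  rewrite det_trig; first by rewrite big1.
  apply/is_trig_mxP => k l kl; rewrite tE.
  case: andP => [[/eqP la /eqP kb]|]; first by move: kl; rewrite la kb; lia.
  by move=> _; rewrite addr0; case: eqP kl => // ->; rewrite ltnn.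
rewrite -det_tr det_trig; first by rewrite big1 // => k _; rewrite mxE diag.
apply/is_trig_mxP => l k kl; rewrite mxE tE.
case: andP => [[/eqP la /eqP kb]|]; first by move: kl; rewrite la kb; lia.
by move=> _; rewrite addr0; case: eqP kl => // ->; rewrite ltnn.
Qed.

Lemma det_tprod s : (\det (aut_mx (@tprod n.+1 s)) = 1)%R.
Proof.
elim: s => [|g s IHs]; first by rewrite aut_mx1 det1.
by rewrite aut_mxM det_mulmx det_transv IHs mulr1.
Qed.

(** The signed transposition [a -> b -> a^-1], following the factorization of a quarter turn into
    three elementary matrices. *)
Definition wswap a b := [:: (linv b, a); (a, b); (b, linv a)].

Lemma wswap_lt a b : a.1 != b.1 ->
  [/\ tprod (wswap a b) (lt a) = lt b,
      tprod (wswap a b) (lt b) = lt (linv a) &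
      forall c, c.1 != a.1 -> c.1 != b.1 -> tprod (wswap a b) (lt c) = lt c].
Proof.
move=> ab; have ba : b.1 != a.1 by rewrite eq_sym.
have E1 : transv (linv b, a) (lt b) = (lt a)^-1 * lt b.
  by rewrite -[b in lt b]linvK ltV autV /= transv_lt // ltV invgM invgK.
have E1a : transv (linv b, a) (lt a) = lt a by apply: transv_fix.
have E2 : transv (a, b) (lt a) = lt a * lt b by apply: transv_lt.
have E2b : transv (a, b) (lt b) = lt b by apply: transv_fix.
have E3a : transv (b, linv a) (lt a) = lt a by apply: transv_fix.
have E3 : transv (b, linv a) (lt b) = lt b * (lt a)^-1 by rewrite /= transv_lt // ltV.
split.
- rewrite [LHS]/= -[extend _ (lt a)]/(transv (b, linv a) (lt a)) E3a.
  rewrite -[extend _ (lt a)]/(transv (a, b) (lt a)) E2.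
  rewrite -[extend _ _]/(transv (linv b, a) _) autM E1 E1a mulgA mulgV mul1g //.
- rewrite [LHS]/= -[extend _ (lt b)]/(transv (b, linv a) (lt b)) E3.
  rewrite -[extend (transv_gen (a, b)) _]/(transv (a, b) _) autM autV E2 E2b.
  rewrite invgM mulgA mulgV mul1g -ltV.
  by rewrite ltV -[extend _ _]/(transv (linv b, a) _) autV E1a.
- by move=> c ca cb; rewrite /= !transv_fix.
Qed.

Let monomial m := forall a, exists b, m (lt a) = lt b.

(** The letter sent to generator [k] has index at least [k], as the smaller generators are fixed. A
    signed transposition moves it into place; if it is the inverse of generator [k], the square of
    one inverts it together with the last generator, whence [k < n]. *)
Let monomial_step m (k : 'I_n.+1) : monomial m -> k < n ->
  (forall i : 'I_n.+1, i < k -> m (fgen i) = fgen i) ->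
  exists s, monomial (m * tprod s) /\
    forall i : 'I_n.+1, i <= k -> (m * tprod s) (fgen i) = fgen i.
Proof.
move=> mm kn mk.
have monoW a b : a.1 != b.1 -> monomial (tprod (wswap a b)).
  move=> ab; have [h1 h2 h3] := wswap_lt ab => c.
  have neg d : tprod (wswap a b) (lt (linv d)) = (tprod (wswap a b) (lt d))^-1.
    by rewrite ltV autV.
  have sp d : c.1 = d.1 -> c = d \/ c = linv d.
    by case: c d => i x [j y] /= ->; case: x y => [] []; [left|right|right|left].
  have [ca|ca] := eqVneq c.1 a.1.
    by case: (sp a ca) => ->; [exists b | exists (linv b); rewrite neg h1 ltV].
  have [cb|cb] := eqVneq c.1 b.1; last by exists c; rewrite h3.
  by case: (sp b cb) => ->; [exists (linv a) | exists a; rewrite neg h2 -ltV linvK].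
have monoM f g : monomial f -> monomial g -> monomial (f * g).
  by move=> fm gm c; have [d dE] := gm c; have [e eE] := fm d; exists e; rewrite /= dE.
pose h a := projT1 (cid (mm a)).
have hE a : m (lt a) = lt (h a) by rewrite /h; case: cid.
have h_inj : injective h.
  move=> a b hab; suff [] : lt a = lt b by [].
  by apply: (can_inj (aut_invK m)); rewrite !hE hab.
have [h' hK h'K] := injF_bij h_inj.
pose a := h' (k, true); have aE : m (lt a) = fgen k by rewrite hE h'K ltT.
have ak : k <= a.1.
  rewrite leqNgt; apply/negP => alt.
  have mE : m (lt a) = lt a.
    case: (a) alt => i [] /= /mk; rewrite ?ltT ?lt_false // autV => ->//.
  by move: aE; rewrite mE => -[aE]; move: alt; rewrite aE /= ltnn.
have [aka|aka] := eqVneq a.1 k; last first.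
  have ka : (k, true).1 != a.1 by rewrite eq_sym.
  have [h1 _ h3] := wswap_lt ka; exists (wswap (k, true) a).
  split; first by apply: (monoM) => //; apply: monoW.
  move=> i; rewrite leq_eqVlt => /orP[/eqP /val_inj -> | ik].
    by rewrite -ltT /= -[X in m X]/(tprod (wswap (k, true) a) (lt (k, true))) h1.
  rewrite -ltT /= -[X in m X]/(tprod (wswap (k, true) a) (lt (i, true))) h3 ?ltT ?mk //=.
    by apply: contraTneq ik => ->; rewrite ltnn.
  by apply: contraTneq ik => ->; rewrite -leqNgt.
case ax: a.2; last first.
  pose b := (@ord_max n, true); have ab : a.1 != b.1.
    by rewrite aka; apply: contraTneq kn => ->; rewrite ltnn.
  have [h1 h2 h3] := wswap_lt ab; exists (wswap a b ++ wswap a b).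
  rewrite tprod_cat; split.
    by apply: (monoM) => //; apply: (monoM); apply: monoW.
  have kE : fgen k = lt (linv a) by rewrite -ltT /linv aka ax.
  have kE' : (tprod (wswap a b) * tprod (wswap a b)) (lt a) = lt (linv a).
    by rewrite -[LHS]/(tprod (wswap a b) (tprod (wswap a b) (lt a))) h1.
  move=> i; rewrite leq_eqVlt => /orP[/eqP /val_inj -> | ik].
    rewrite -[LHS]/(m ((tprod (wswap a b) * tprod (wswap a b)) (fgen k))).
    by rewrite {1}kE ltV autV kE' -ltV linvK.
  have ia : (i, true).1 != a.1 by rewrite aka; apply: contraTneq ik => /= ->; rewrite ltnn.
  have ib : (i, true).1 != b.1.
    by apply: contraTneq ik => /= ->; rewrite -leqNgt ltnW.
  rewrite -[LHS]/(m (tprod (wswap a b) (tprod (wswap a b) (fgen i)))).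
  by rewrite -ltT !h3 // ltT mk.
exists [::]; rewrite /= mulg1; split=> // i.
rewrite leq_eqVlt => /orP[/eqP /val_inj -> | /mk //].
by rewrite -[RHS]aE -ltT -aka -ax; case: (a).
Qed.

(** Straightening the generators one after the other leaves only the sign of the last one, which the
    determinant decides. *)
Let monomial_tprod m : monomial m -> (\det (aut_mx m) = 1)%R ->
  exists s, m = tprod s.
Proof.
move=> mm m1.
have reach k : k <= n -> exists s, monomial (m * tprod s) /\
    forall i : 'I_n.+1, i < k -> (m * tprod s) (fgen i) = fgen i.
  elim: k => [|k IHk] kn; first by exists [::]; rewrite /= mulg1.
  have [s [sm sk]] := IHk (ltnW kn).
  have kE : @inord n k = k :> nat by rewrite inordK // ltnS ltnW.
  have [||t [tm tk]] := @monomial_step (m * tprod s) (inord k) sm.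
  - by rewrite kE.
  - by move=> i; rewrite kE; apply: sk.
  exists (s ++ t); rewrite tprod_cat mulgA; split=> // i ik.
  by apply: tk; rewrite kE.
have {reach} [s [sm sk]] := reach n (leqnn n).
suff ms1 : m * tprod s = 1.
  exists (winv s); rewrite tprod_winv.
  by apply: (mulIg (tprod s)); rewrite ms1 mulVg.
have {m1} : (\det (aut_mx (m * tprod s)%g) = 1)%R.
  by rewrite aut_mxM det_mulmx m1 det_tprod mulr1.
move: (m * tprod s) sm sk => {m mm s} m mm mk m1.
have [[j y] mE] := mm (ord_max, true); rewrite ltT in mE.
have jE : j = ord_max.
  apply/eqP; rewrite -val_eqE /= eqn_leq leq_ord leqNgt /=; apply/negP => jn.
  have mj : m (lt (j, y)) = lt (j, y).
    by case: (y); rewrite ?ltT ?lt_false ?autV mk.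
  have : fgen ord_max = lt (j, y) by apply: (can_inj (aut_invK m)); rewrite mj.
  by move=> /(congr1 (fun u => fword u)) [] jE; move: jn; rewrite -jE /= ltnn.
have {mE} mE : m (fgen ord_max) = lt (ord_max, y) by rewrite mE jE.
apply: aut_lt_eq => i; rewrite [RHS]/=.
have [->|im] := eqVneq i ord_max; last first.
  apply: mk; have := ltn_ord i; rewrite ltnS leq_eqVlt => /orP[/eqP iE|//].
  by case/eqP: im; apply: val_inj.
case: y mE => mE; first by rewrite mE ltT.
suff : (\det (aut_mx m) = -1)%R by rewrite m1.
have -> : aut_mx m = diag_mx (\row_(j < n.+1) (if j == ord_max then -1 else 1))%R.
  apply/matrixP => k l; rewrite !mxE.
  have [->|lm] := eqVneq l ord_max.
    by rewrite mE lt_false abV ab_fgen !mxE eqxx andbT; case: eqP.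
  have ln : l < n.
    rewrite ltn_neqAle -ltnS ltn_ord andbT.
    by apply: contra lm => /eqP lE; apply/eqP/val_inj.
  rewrite mk // ab_fgen mxE eqxx andbT.
  by case: (eqVneq k l) => [->|_]; rewrite ?(negPf lm).
rewrite det_diag (bigD1 ord_max) //= mxE eqxx big1 ?mulr1 // => l /negPf lm.
by rewrite mxE lm.
Qed.

Theorem special_aut_tprod f : (\det (aut_mx f) = 1)%R -> exists s, f = tprod s.
Proof.
(* The descent makes every generator the image of a letter; applied to [f^-1], this says that the
   inverse map [tprod t * f] sends letters to letters. *)
move=> f1; have [s sE] := nielsen_descent f^-1.
have tE := esym (tprod_winv s); set t := winv s in tE.
have mm : monomial (tprod t * f).
  have tfE u v : (f^-1 * tprod s) u = v -> (tprod t * f) v = u.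
    by move=> <-; rewrite -[LHS]/((tprod t * f * (f^-1 * tprod s)) u) -mulgA mulKVg -tE mulVg.
  case=> i [].
    by have [a aE] := sE i; exists a; rewrite ltT; apply: tfE.
  have [a aE] := sE i; exists (linv a).
  by rewrite lt_false autV (tfE _ _ aE) ltV.
have [|r rE] := monomial_tprod mm; first by rewrite aut_mxM det_mulmx det_tprod f1 mulr1.
by exists (s ++ r); rewrite tprod_cat -rE -tE mulKVg.
Qed.

End SpecialAut.

(** * Permutations of seven points *)

Section Perm7.
Implicit Types g : 'S_7.

(** Every cycle length divides 8 and is at most 7, hence divides 4. *)
Lemma perm7_expg8 g : g ^+ 8 = 1 -> g ^+ 4 = 1.
Proof.
move=> g8; apply/permP => x; rewrite perm1 permX.
have k8 : #|porbit g x| %| 8.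
  apply: dvdn_trans (_ : #[g] %| 8); last by rewrite order_dvdn g8.
  by rewrite porbitE dvdn_orbit.
have k7 : #|porbit g x| <= 7 by have := max_card (mem (porbit g x)); rewrite card_ord.
move: k8 k7 (iter_porbit g x); move: #|porbit g x| => k k8 k7 gk.
have /dvdnP[q qE] : k %| 4 by case: k {gk} k8 k7 => [|[|[|[|[|[|[|[|]]]]]]]].
suff : iter (q * k) g x = x by rewrite -qE.
by elim: q {qE} => [|q IHq]; rewrite // mulSn iterD IHq gk.
Qed.

(** A product [a * b] of two involutions with [a ^ b] disjoint from [a]; its square is [a * a ^ b],
    of order two. *)
Let four_cycle : 'S_7 :=
  tperm (inord 0) (inord 1) * (tperm (inord 0) (inord 2) * tperm (inord 1) (inord 3)).

Let four_cycle_sqr : four_cycle ^+ 2 != 1.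
Proof.
apply/eqP => /permP/(_ (inord 0)); rewrite permX perm1 /= /four_cycle !permM !permE /=.
rewrite -!val_eqE /= !inordK //= ?inordK //.
move=> /(congr1 val).
by rewrite /= !inordK.
Qed.

Let four_cycle_order : four_cycle ^+ 4 = 1.
Proof.
set a := tperm (inord 0) (inord 1) : 'S_7.
set b := tperm (inord 0) (inord 2) * tperm (inord 1) (inord 3) : 'S_7.
have D i j : i < 7 -> j < 7 -> i != j -> (inord i : 'I_7) != inord j.
  by move=> i7 j7 ij; rewrite -val_eqE /= !inordK.
have tC (i j k l : 'I_7) : i != k -> i != l -> j != k -> j != l ->
    commute (tperm i j) (tperm k l).
  move=> ik il jk jl; apply/commgP/conjg_fixP; rewrite tpermJ.
  by rewrite !tpermD // eq_sym.
have bb : b * b = 1.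
  rewrite /b -mulgA [X in _ * X]mulgA [X in _ * (X * _)]tC ?D //.
  by rewrite !mulgA tperm2 mul1g tperm2.
have aJ : a ^ b = tperm (inord 2) (inord 3).
  rewrite /b conjgM /a !tpermJ.
  by rewrite tpermL [tperm _ _ (inord 1)]tpermD ?D // tpermL [tperm _ _ (inord 2)]tpermD ?D.
have bV : b^-1 = b by apply: (mulgI b); rewrite mulgV bb.
have sq : four_cycle ^+ 2 = a * tperm (inord 2) (inord 3).
  by rewrite -aJ conjgE bV expgS expg1 /four_cycle -/a -/b !mulgA.
rewrite (expgM _ 2 2) sq expgMn; last by apply: tC; apply: D.
by rewrite !expgS !expg0 !mulg1 /a !tperm2 mulg1.
Qed.

(** Otherwise the 16 products are distinct and form a Sylow 2-subgroup, 16 being the 2-part of [7!].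
    It would contain a conjugate of [four_cycle], although all its elements square to 1. *)
Lemma perm7_involutions (a b c d : 'S_7) :
  a * a = 1 -> b * b = 1 -> c * c = 1 -> d * d = 1 ->
  commute a b -> commute a c -> commute a d ->
  commute b c -> commute b d -> commute c d ->
  exists e : (bool * bool) * (bool * bool),
    e != ((false, false), (false, false)) /\
    a ^+ e.1.1 * b ^+ e.1.2 * (c ^+ e.2.1 * d ^+ e.2.2) = 1.
Proof.
move=> a2 b2 c2 d2 ab ac ad bc bd cd.
pose F (e : (bool * bool) * (bool * bool)) :=
  a ^+ e.1.1 * b ^+ e.1.2 * (c ^+ e.2.1 * d ^+ e.2.2).
pose add (e e' : (bool * bool) * (bool * bool)) :=
  ((e.1.1 (+) e'.1.1, e.1.2 (+) e'.1.2), (e.2.1 (+) e'.2.1, e.2.2 (+) e'.2.2)).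
have expD x (p q : bool) : x * x = 1 -> x ^+ p * x ^+ q = x ^+ (p (+) q) :> 'S_7.
  by move=> x2; case: p q => [] []; rewrite ?expg1 ?expg0 ?mulg1 ?mul1g.
have cX (x y : 'S_7) (p q : nat) : commute x y -> commute (x ^+ p) (y ^+ q).
  by move=> xy; apply: commuteX; apply: commute_sym; apply: commuteX; apply: commute_sym.
have mulACA (x y z t : 'S_7) : commute y z -> x * y * (z * t) = x * z * (y * t).
  by move=> yz; rewrite !mulgA -[x * y * z]mulgA yz !mulgA.
have FM e e' : F e * F e' = F (add e e').
  rewrite /F /= mulACA; last first.
    by apply: commuteM; apply: commute_sym; apply: commuteM; apply: cX => //;
      apply: commute_sym.
  rewrite (mulACA (a ^+ _)); last by apply: cX; apply: commute_sym.
  rewrite (mulACA (c ^+ _)); last by apply: cX; apply: commute_sym.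
  by rewrite !expD.
have F0 : F ((false, false), (false, false)) = 1 by rewrite /F /= !mulg1.
have F2 e : F e * F e = 1 by rewrite FM /add !addbb F0.
apply/not_existsP => noE.
have Finj : injective F.
  move=> e e' eE; have : F (add e e') = 1 by rewrite -FM eE F2.
  move=> aE; have /not_andP[/negP/negPn/eqP|//] := noE (add e e').
  have addb0 (p q : bool) : p (+) q = false -> p = q by case: p q => [] [].
  by case: e e' {eE aE} => [[? ?] [? ?]] [[? ?] [? ?]] []; do 4!move/addb0->.
pose E := [set F e | e in [set: (bool * bool) * (bool * bool)]].
have E_group : group_set E.
  apply/group_setP; split; first by rewrite -F0 imset_f.
  by move=> x y /imsetP[e _ ->] /imsetP[e' _ ->]; rewrite FM imset_f.
have cE : #|E| = 16%N by rewrite card_imset // cardsT !card_prod card_bool.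
have sylE : 2.-Sylow([set: 'S_7]) (Group E_group).
  by rewrite pHallE finset.subsetT /= cE cardsT card_Sn p_part; vm_compute.
have pt : 2.-group <[four_cycle]>.
  rewrite /pgroup; apply: (@pnat_dvd _ 4) => //.
  by rewrite -orderE order_dvdn four_cycle_order.
have [x _ /fintype.subsetP/(_ (four_cycle ^ x))] := Sylow_Jsub sylE (finset.subsetT _) pt.
rewrite memJ_conjg cycle_id => /(_ isT)/imsetP[e _ eE].
have := F2 e; rewrite -eE -conjMg => /eqP; rewrite conjg_eq1.
by move=> h; move: four_cycle_sqr; rewrite expgS expg1 h.
Qed.

End Perm7.

(** * Representations on seven points *)

Section Relations.

Let o (k : nat) : 'I_4 :=
  match k with
  | 0 => @Ordinal 4 0 isT | 1 => @Ordinal 4 1 isT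
  | 2 => @Ordinal 4 2 isT | _ => @Ordinal 4 3 isT
  end.
Let x k : letter 4 := (o k, true).
Let X k : letter 4 := (o k, false).
Let letters := [:: x 0; x 1; x 2; x 3; X 0; X 1; X 2; X 3].
Let tword := seq (letter 4 * letter 4).

(** Starts a model of the transvections on bare words, without proofs of reducedness, in which
    [vm_compute] decides equality of products. *)
Definition transv_image (g : letter 4 * letter 4) (c : letter 4) :=
  if (c.1 == g.1.1) && (g.1.1 != g.2.1) then
    if c.2 == g.1.2 then [:: g.1; g.2] else [:: linv g.2; linv g.1]
  else [:: c].

Definition transv_word g (w : seq (letter 4)) : seq (letter 4) :=
  foldr (fun c v => act_word (transv_image g c) v) [::] w.

Definition tprod_word (s : tword) (w : seq (letter 4)) : seq (letter 4) :=
  foldr transv_word w s.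

Lemma tprod_wordE s u : fword (tprod s u) = tprod_word s (fword u).
Proof.
elim: s u => //= [[a b] s] IHs u; rewrite -IHs.
move: (tprod s u) => v.
rewrite [LHS]/= /extend /transv_word; elim: (fword v) => //= c w ->.
congr act_word; rewrite /extend_letter /transv_gen /transv_image /=.
have [ca|ca] /= := eqVneq c.1 a.1; last by case: c {ca} => i [].
have [ab|ab] /= := eqVneq a.1 b.1; first by case: c ca => i [].
have lab : (if b == linv a then [::] else [:: a; b]) = [:: a; b].
  by case: eqP => // ba; move: ab; rewrite ba eqxx.
case: c {ca} => i y /=; case: y; case: a.2;
  by rewrite ?fword_inv /= ?fword_inv /= lab ?inv_wordK.
Qed.

Definition timages (s : tword) :=
  [seq tprod_word s [:: x k] | k <- [:: 0; 1; 2; 3]%N].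

Definition teq (s t : tword) : bool := timages s == timages t.

Lemma teqP s t : teq s t -> tprod s = tprod t.
Proof.
move=> /eqP[h0 h1 h2 h3]; apply: aut_lt_eq => i; apply: val_inj.
rewrite /= !tprod_wordE.
have [k [k4 ->]] : exists k, k < 4 /\ i = o k.
  by exists i; split=> //; case: i => [[|[|[|[|]]]] i4] //; apply: val_inj.
by case: k k4 => [|[|[|[|]]]].
Qed.

Definition tcomm (s t : tword) : tword := winv s ++ t ++ s ++ winv t.
Definition tconj (m s : tword) : tword := m ++ s ++ winv m.

Definition proper_transvs : tword :=
  [seq (a, b) | a <- letters, b <- [seq b <- letters | a.1 != b.1]].

Lemma mem_proper_transvs g : g.1.1 != g.2.1 -> g \in proper_transvs.
Proof.
have mem_letters (c : letter 4) : c \in letters.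
  by case: c => [[[|[|[|[|]]]] i4] []].
case: g => a b ab; apply/allpairsPdep; exists a, b; split=> //.
by rewrite mem_filter ab mem_letters.
Qed.

(** The square of a signed transposition inverts both of its generators. *)
Definition flip i j : tword := wswap (x i) (x j) ++ wswap (x i) (x j).
Definition flips :=
  [:: flip 0 1; flip 0 2; flip 0 3; flip 1 2; flip 1 3; flip 2 3].

(* These 48 words carry x_0 and x_1 to every pair of letters from distinct
   generators. *)
Definition frames : seq tword :=
  [seq s ++ t |
    s <- [:: [::]; flip 0 2] ++
         [seq wswap (x 0) a | a <- letters & a.1 != o 0],
    t <- [:: [::]; flip 1 2] ++
         [seq wswap (x 1) a | a <- letters & a.1 \notin [:: o 0; o 1]]].

(** A Coxeter element of the group of signed permutations, of order 8. *)
Definition coxeter :=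
  wswap (x 0) (x 1) ++ wswap (x 1) (x 2) ++ wswap (x 2) (x 3).
(* The automorphism inverting every generator. *)
Definition center := coxeter ++ coxeter ++ coxeter ++ coxeter.

Definition n1 := flip 0 1.
Definition n2 := flip 0 2.
(* The double transpositions (0 1)(2 3) and (0 2)(1 3) of the generators. *)
Definition v1 := wswap (x 0) (x 1) ++ wswap (x 2) (x 3) ++ flip 1 3.
Definition v2 := wswap (x 0) (x 2) ++ wswap (x 1) (x 3) ++ flip 2 3.

Definition select (s0 s1 s2 s3 : tword) (e : (bool * bool) * (bool * bool)) :=
  ((if e.1.1 then s0 else [::]) ++ (if e.1.2 then s1 else [::])) ++
  ((if e.2.1 then s2 else [::]) ++ (if e.2.2 then s3 else [::])).

(* If u dies in a quotient, so does the commutator of g with a conjugate of h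
   by u; when that one is trivial, the transvection [g, h] dies. *)
Definition moves_transv (u : tword) :=
  has (fun p : (letter 4 * letter 4) * letter 4 =>
    let: (i, j, k) := p in
    teq (tcomm [:: (k, i)] [:: (i, j)]) [:: (k, j)] &&
    teq (tcomm [:: (k, i)] (tconj u [:: (i, j)])) [::])
  [:: (x 0, x 1, x 2); (x 0, x 2, x 1); (x 0, x 3, x 1)].

(** If [u] dies, so does every double commutator [[[u, t], t']]; the test looks for one that is a
    transvection of [i] by [j] or its inverse, on either side. *)
Definition second_comm_transv (u : tword) :=
  has (fun p : letter 4 * letter 4 * letter 4 =>
    let: (i, j, k) := p in
    has (fun g => teq (tcomm (tcomm u [:: (i, j)]) [:: (i, k)]) [:: g])
      [:: (i, j); (linv i, j); (i, linv j); (linv i, linv j)])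
  [seq (p, k) | p <- [:: (x 2, x 3); (x 3, x 2)], k <- [:: x 0; X 0; x 1; X 1]].

(** Each of [x_0] and [x_1] is multiplied by [x_2] on the right or by the inverse of [x_3] on the
    left; acting on distinct generators or distinct sides, the four transvections commute. *)
Let e1 : tword := [:: (x 0, x 2)].
Let e2 : tword := [:: (X 0, x 3)].
Let e3 : tword := [:: (x 1, x 2)].
Let e4 : tword := [:: (X 1, x 3)].

(** The representation is given on words, so that relations verified by computation apply
    directly. *)
Variable psi : tword -> 'S_7.
Hypothesis psi_cat : forall s t, psi (s ++ t) = psi s * psi t.
Hypothesis psi_tprod : forall s t, tprod s = tprod t -> psi s = psi t.

Let psi_teq s t : teq s t -> psi s = psi t.
Proof. by move/teqP/psi_tprod. Qed.

Let psi_nil : psi [::] = 1.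
Proof. by apply: (mulgI (psi [::])); rewrite -psi_cat mulg1. Qed.

Let psi_winv s : psi (winv s) = (psi s)^-1.
Proof.
apply: (mulgI (psi s)); rewrite -psi_cat mulgV -psi_nil; apply: psi_tprod.
by rewrite tprod_cat tprod_winv mulgV.
Qed.

Let psi_tcomm s t :
  psi (tcomm s t) = (psi s)^-1 * (psi t * (psi s * (psi t)^-1)).
Proof. by rewrite !psi_cat !psi_winv. Qed.

Let psi_tconj m s : psi (tconj m s) = psi m * (psi s * (psi m)^-1).
Proof. by rewrite !psi_cat psi_winv. Qed.

Let psi_conj m s : psi s = 1 -> psi (tconj m s) = 1.
Proof. by move=> s1; rewrite !psi_cat s1 psi_winv mul1g mulgV. Qed.

Let psi_select s0 s1 s2 s3 e : psi (select s0 s1 s2 s3 e) =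
  psi s0 ^+ e.1.1 * psi s1 ^+ e.1.2 * (psi s2 ^+ e.2.1 * psi s3 ^+ e.2.2).
Proof.
by rewrite /select !psi_cat; case: e => [[[] []] [[] []]] /=; rewrite ?psi_nil.
Qed.

Let psi_comm s t : teq (tcomm s t) [::] -> commute (psi s) (psi t).
Proof.
move=> /psi_teq; rewrite psi_nil !psi_cat !psi_winv => h.
apply: (mulgI (psi s)^-1); rewrite mulKg; apply: (mulIg (psi t)^-1).
by rewrite mulgV -h !mulgA.
Qed.

(** The [frames] conjugate one transvection into all proper ones, so a kernel containing one
    contains all; degenerate pairs are trivial anyway. *)
Let kill_all k :
  k \in proper_transvs -> psi [:: k] = 1 -> forall t, psi t = 1.
Proof.
move=> kp k1.
have conn : all (fun g => has (fun m => teq (tconj m [:: (x 0, x 1)]) [:: g])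
    frames) proper_transvs by vm_compute.
have h0 : psi [:: (x 0, x 1)] = 1.
  have /hasP[m _ /psi_teq] := allP conn k kp.
  rewrite k1 !psi_cat psi_winv => mE.
  by apply: (mulIg (psi m)^-1); rewrite mul1g; apply: (mulgI (psi m)); rewrite mE mulgV.
elim=> [|[a b] t IHt]; first exact: psi_nil.
rewrite -cat1s psi_cat IHt mulg1.
have [ab|ab] := eqVneq a.1 b.1.
  rewrite -psi_nil; apply: psi_tprod; rewrite tprod1.
  by apply: aut_eq => u; apply: transv_degenerate.
have abp : (a, b) \in proper_transvs by apply: mem_proper_transvs.
have /hasP[m _ /psi_teq <-] := allP conn _ abp.
exact: psi_conj.
Qed.

Let psi_center : psi center = 1.
Proof.
have c8 : psi coxeter ^+ 8 = 1.
  rewrite !expgS expg0 mulg1 -!psi_cat -psi_nil; apply: psi_teq.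
  by vm_compute.
by have := perm7_expg8 c8; rewrite !expgS expg0 mulg1 -!psi_cat.
Qed.

Let flips_die_all : (forall s, s \in flips -> psi s = 1) -> forall t, psi t = 1.
Proof.
move=> flips1.
have flipE g m g' : m \in flips ->
    teq (tconj m [:: g]) [:: g'] -> psi [:: g'] = psi [:: g].
  by move=> mf /psi_teq <-; rewrite !psi_cat psi_winv flips1 // invg1 mul1g mulg1.
have chk : all (fun g : letter 4 * letter 4 =>
    has (fun m => teq (tconj m [:: g]) [:: (g.1, linv g.2)]) flips &&
    has (fun m => teq (tconj m [:: g]) [:: (linv g.1, g.2)]) flips)
    proper_transvs by vm_compute.
(* Conjugation by some flip inverts [g], and flips are killed, so the image of [g] is its own
   inverse. *)
have sqr g : g \in proper_transvs -> psi [:: g] * psi [:: g] = 1.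
  move=> gp; have /andP[/hasP[m mf /(flipE _ _ _ mf) gV] _] := allP chk g gp.
  rewrite -{2}gV -psi_cat -psi_nil; apply: psi_tprod; rewrite tprod_cat !tprod1.
  have := tprod_winv [:: g]; rewrite /winv /= !mulg1 => ->.
  by rewrite mulgV.
have i1 : psi e1 * psi e1 = 1 by apply: sqr; apply: mem_proper_transvs.
have i2 : psi e2 * psi e2 = 1 by apply: sqr; apply: mem_proper_transvs.
have i3 : psi e3 * psi e3 = 1 by apply: sqr; apply: mem_proper_transvs.
have i4 : psi e4 * psi e4 = 1 by apply: sqr; apply: mem_proper_transvs.
have c12 : commute (psi e1) (psi e2) by apply: psi_comm; vm_compute.
have c13 : commute (psi e1) (psi e3) by apply: psi_comm; vm_compute.
have c14 : commute (psi e1) (psi e4) by apply: psi_comm; vm_compute.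
have c23 : commute (psi e2) (psi e3) by apply: psi_comm; vm_compute.
have c24 : commute (psi e2) (psi e4) by apply: psi_comm; vm_compute.
have c34 : commute (psi e3) (psi e4) by apply: psi_comm; vm_compute.
have [e [e0]] := perm7_involutions i1 i2 i3 i4 c12 c13 c14 c23 c24 c34.
rewrite -psi_select => u1.
have : second_comm_transv (select e1 e2 e3 e4 e).
  move: e0 {u1}; case: e => [[[] []] [[] []]] // _; vm_compute; reflexivity.
move: (select _ _ _ _ _) u1 => u u1 /hasP[[[i j] k] ip /hasP[g gp /psi_teq gE]].
have comm1 s t : psi s = 1 -> psi (tcomm s t) = 1.
  by move=> s1; rewrite psi_tcomm s1 invg1 !mul1g mulgV.
apply: (@kill_all g); last by rewrite -gE; do 2!apply: (comm1).
have /allpairsP[[p k'] [pp _ pE]] := ip.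
have pij : p = (i, j) by case: pE.
have ij : i.1 != j.1 by move: pp; rewrite pij !inE => /orP[] /eqP[-> ->].
apply: mem_proper_transvs; move: gp; rewrite !inE.
by case/or4P=> /eqP->.
Qed.

Lemma perm7_rep_trivial t : psi t = 1.
Proof.
have c1 := psi_center.
have invol s : teq (s ++ s) [::] -> psi s * psi s = 1.
  by move/psi_teq; rewrite psi_cat psi_nil.
(* Some flips and double transpositions commute only up to [center], which is already killed. *)
have commc s t' : teq (tcomm s t') center -> commute (psi s) (psi t').
  move=> /psi_teq; rewrite c1 !psi_cat !psi_winv => h.
  apply: (mulgI (psi s)^-1); rewrite mulKg; apply: (mulIg (psi t')^-1).
  by rewrite mulgV -h !mulgA.
have i1 : psi n1 * psi n1 = 1 by apply: invol; vm_compute.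
have i2 : psi n2 * psi n2 = 1 by apply: invol; vm_compute.
have i3 : psi v1 * psi v1 = 1 by apply: invol; vm_compute.
have i4 : psi v2 * psi v2 = 1 by apply: invol; vm_compute.
have c12 : commute (psi n1) (psi n2) by apply: psi_comm; vm_compute.
have c13 : commute (psi n1) (psi v1) by apply: psi_comm; vm_compute.
have c14 : commute (psi n1) (psi v2) by apply: commc; vm_compute.
have c23 : commute (psi n2) (psi v1) by apply: commc; vm_compute.
have c24 : commute (psi n2) (psi v2) by apply: psi_comm; vm_compute.
have c34 : commute (psi v1) (psi v2) by apply: psi_comm; vm_compute.
have [e [e0]] := perm7_involutions i1 i2 i3 i4 c12 c13 c14 c23 c24 c34.
rewrite -psi_select; case: e e0 => n [v v']; case: (boolP (v || v')) => vv e0 u1.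
  have : moves_transv (select n1 n2 v1 v2 (n, (v, v'))).
    by move: vv {u1 e0}; case: n v v' => [[] []] [] [] // _; vm_compute.
  move: (select _ _ _ _ _) u1 => u u1 /hasP[[[i j] k] ip /andP[/psi_teq kE /psi_teq uE]].
  apply: (@kill_all (k, j)).
    by apply: mem_proper_transvs; move: ip; rewrite !inE => /or3P[] /eqP[_ -> ->].
  by rewrite -kE -psi_nil -uE !psi_tcomm psi_tconj u1 invg1 mulg1 mul1g.
(* No double transposition occurs here, so the killed element is a nontrivial product of [n1] and
   [n2], again a flip. *)
have /hasP[s sf /psi_teq sE] : has (teq (select n1 n2 v1 v2 (n, (v, v')))) flips.
  by move: vv e0 {u1}; case: n v v' => [[] []] [] [] // _; vm_compute.
rewrite sE in u1.
have chk : all (fun p => has (fun m => teq (tconj m (flip 0 1)) p) frames) flips.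
  by vm_compute.
have h0 : psi (flip 0 1) = 1.
  have /hasP[m _ /psi_teq] := allP chk s sf.
  rewrite u1 psi_cat [psi (flip 0 1 ++ _)]psi_cat psi_winv => mE.
  by apply: (mulIg (psi m)^-1); rewrite mul1g; apply: (mulgI (psi m)); rewrite mE mulgV.
apply: flips_die_all => p /(allP chk)/hasP[m _ /psi_teq <-].
exact: psi_conj.
Qed.

End Relations.

(** * Subgroups of small index *)

Section CosetActions.
Local Open Scope classical_set_scope.
Local Open Scope card_scope.
Variable G : groupType.
Implicit Types H K : set G.

Lemma group_closedE K : group_closed (mem K) ->
  [/\ K 1, forall u v, K u -> K v -> K (u * v) & forall u, K u -> K u^-1].
Proof.
case; rewrite inE => K1 Kdiv.
have KV u : K u -> K u^-1.
  by move=> Ku; have := Kdiv 1 u; rewrite !inE mul1g; apply.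
split=> // u v Ku Kv; have := Kdiv u v^-1; rewrite !inE invgK; apply=> //.
exact: KV.
Qed.

Lemma coset_of_setM H u v :
  coset_of_set H (u * v) = (fun z => z * v) @` coset_of_set H u.
Proof.
apply/seteqP; split=> [_ [h Hh <-]|_ [_ [h Hh <-] <-]].
  by exists (h * u); [exists h | rewrite mulgA].
by exists h => //; rewrite mulgA.
Qed.

Lemma coset_of_set_eq H u v : group_closed (mem H) ->
  coset_of_set H u = coset_of_set H v <-> H (u * v^-1).
Proof.
move=> /group_closedE[H1 HM HV]; split=> [uv|Huv].
  have : coset_of_set H u u by exists 1; rewrite ?mul1g.
  by rewrite uv => -[h Hh <-]; rewrite mulgK.
apply/seteqP; split=> _ [h Hh <-].
  by exists (h * (u * v^-1)); [apply: HM | rewrite -mulgA mulgVK].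
exists (h * (u * v^-1)^-1); first by apply: HM => //; apply: HV.
by rewrite invgM invgK -!mulgA mulVg mulg1.
Qed.

(** The map [F] enlarges a coset of the intersection to one of [H]. It is injective because
    representatives in [K] of the same coset of [H] differ by an element of both groups. *)
Lemma coset_set_setI H K L : group_closed (mem H) -> group_closed (mem K) ->
  K `<=` L -> coset_set (H `&` K) K #<= coset_set H L.
Proof.
move=> Hgr Kgr KL; have [H1 HM HV] := group_closedE Hgr.
have [K1 KM KV] := group_closedE Kgr.
have HKgr : group_closed (mem (H `&` K)).
  split; first by rewrite inE.
  move=> u v; rewrite !inE => -[Hu Ku] [Hv Kv].
  by split; [apply: HM => //; apply: HV | apply: KM => //; apply: KV].
pose F (c : set G) := [set z | exists2 u, c u & H (z * u^-1)].
have FE x : F (coset_of_set (H `&` K) x) = coset_of_set H x.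
  apply/seteqP; split=> [z [_ [h [Hh _] <-]]|_ [h Hh <-]].
    rewrite invgM mulgA => Hz; exists (z * x^-1 * h^-1 * h); first exact: HM.
    by rewrite mulgVK mulgVK.
  by exists x; [exists 1; rewrite ?mul1g | rewrite mulgK].
apply: (card_le_trans (B := F @` coset_set (H `&` K) K)).
  suff : F @` coset_set (H `&` K) K #= coset_set (H `&` K) K.
    by rewrite card_eq_le => /andP[].
  apply: inj_card_eq => c d; rewrite !inE => -[x Kx <-] [y Ky <-].
  rewrite !FE => /(coset_of_set_eq _ _ Hgr) Hxy; apply/coset_of_set_eq => //.
  by split=> //; apply: KM => //; apply: KV.
apply: subset_card_le => _ [_ [x Kx <-] <-]; rewrite FE.
by exists x => //; apply: KL.
Qed.

Lemma card_lt_injective (T : Type) (A : set T) n :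
  ~ (`I_n.+2 #<= A) -> exists f : T -> 'I_n.+1, {in A &, injective f}.
Proof.
move=> An; have finA : finite_set A.
  apply: contrapT => /infiniteP natA; apply: An.
  exact: card_le_trans (card_leT _) natA.
have /finite_setP[k Ak] := finA.
have kn : (k <= n.+1)%N.
  rewrite leqNgt; apply/negP => nk; apply: An.
  apply: (card_le_trans (B := `I_k)); first by rewrite card_le_II.
  by move: Ak; rewrite card_eq_le => /andP[].
have /pcard_leP/injfunPex[g gA g_inj] : A #<= `I_n.+1.
  apply: (card_le_trans (B := `I_k)); last by rewrite card_le_II.
  by move: Ak; rewrite card_eq_le => /andP[].
exists (fun x => inord (g x)) => x y; rewrite !inE => Ax Ay /(congr1 val) /=.
by rewrite !inordK; [move/g_inj; rewrite !inE; apply | apply: gA | apply: gA].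
Qed.

(** Right translation of cosets, carried over to [n + 1] points by an injection [f]; points that
    label no coset stay fixed. *)
Lemma coset_perm_rep H K n : group_closed (mem K) ->
  ~ (`I_n.+2 #<= coset_set H K) ->
  exists (phi : G -> 'S_n.+1) (i0 : 'I_n.+1),
    (forall u v, K u -> K v -> phi (u * v) = phi u * phi v) /\
    (forall u, K u -> phi u i0 = i0 -> coset_of_set H u = coset_of_set H 1).
Proof.
move=> /group_closedE[K1 KM KV] /card_lt_injective[f f_inj].
pose shift u (c : set G) := (fun z => z * u) @` c.
have shiftK u : cancel (shift u) (shift u^-1).
  move=> c; apply/seteqP; split=> [_ [_ [z cz <-] <-]|z cz]; first by rewrite mulgK.
  by exists (z * u); [exists z | rewrite mulgK].
have shiftM u v c : shift (u * v) c = shift v (shift u c).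
  apply/seteqP; split=> [_ [z cz <-]|_ [_ [z cz <-] <-]].
    by exists (z * u); [exists z | rewrite mulgA].
  by exists z => //; rewrite mulgA.
have shift_coset u c : K u -> coset_set H K c -> coset_set H K (shift u c).
  by move=> Ku [x Kx <-]; exists (x * u); [apply: KM | rewrite coset_of_setM].
pose onI i := exists c, coset_set H K c /\ f c = i.
pose act u i := if pselect (onI i) is left h then f (shift u (projT1 (cid h))) else i.
have actE u c : K u -> coset_set H K c -> act u (f c) = f (shift u c).
  move=> Ku Kc; rewrite /act; case: pselect => [h|[]]; last by exists c.
  case: cid => d /= [Kd dc]; congr (f (shift u _)).
  by apply: f_inj; rewrite ?inE.
have actN u i : ~ onI i -> act u i = i by rewrite /act; case: pselect.
have actM u v i : K u -> K v -> act (u * v) i = act v (act u i).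
  move=> Ku Kv; have [[c [Kc <-]]|ni] := pselect (onI i); last by rewrite !actN.
  by rewrite !actE ?shiftM //; [apply: shift_coset | apply: KM].
have act1 i : act 1 i = i.
  have [[c [Kc <-]]|ni] := pselect (onI i); last by rewrite !actN.
  rewrite actE //; congr f; apply/seteqP; split=> [_ [z cz <-]|z cz].
    by rewrite mulg1.
  by exists z; rewrite ?mulg1.
have act_inj u : K u -> injective (act u).
  move=> Ku; apply: (can_inj (g := act u^-1)) => i.
  by rewrite -actM ?mulgV ?act1 //; apply: KV.
(* The default 1 is met only where [act u] is not a permutation, hence never for [u] in [K]. *)
pose phi u : 'S_n.+1 := odflt 1 [pick s : 'S_n.+1 | [forall i, s i == act u i]].
have phiE u i : K u -> phi u i = act u i.
  move=> Ku; rewrite /phi; case: pickP => [s /forallP/(_ i)/eqP //|/(_ (perm (act_inj u Ku)))].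
  by move/negP => []; apply/forallP => j; rewrite permE.
exists phi, (f (coset_of_set H 1)).
have KH1 : coset_set H K (coset_of_set H 1) by exists 1.
split=> [u v Ku Kv | u Ku].
  by apply/permP => i; rewrite permM !phiE ?actM //; apply: KM.
rewrite phiE // actE // => fE; rewrite -[u in LHS]mul1g coset_of_setM.
by apply: f_inj; rewrite ?inE //; apply: shift_coset.
Qed.

(** Orbit and stabilizer: a coset of [H] consists of the elements of [K] with a given image of
    [i0]. *)
Lemma point_stabilizer_index K n (phi : G -> 'S_n.+1) (i0 : 'I_n.+1) :
  group_closed (mem K) ->
  (forall u v, K u -> K v -> phi (u * v) = phi u * phi v) ->
  (forall i, exists2 u, K u & phi u i0 = i) ->
  let H := [set u | K u /\ phi u i0 = i0] in
  subgroup H K /\ has_index H K n.+1.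
Proof.
move=> Kgr phiM phi_tr H; have [K1 KM KV] := group_closedE Kgr.
have phi1 : phi 1 = 1 by apply: (mulgI (phi 1)); rewrite -phiM // !mulg1.
have phiV u : K u -> phi u^-1 = (phi u)^-1.
  by move=> Ku; apply: (mulgI (phi u)); rewrite -phiM ?mulgV //; apply: KV.
split.
  split; last by move=> u [].
  split; first by rewrite inE; split; rewrite // phi1 perm1.
  move=> u v; rewrite !inE => -[Ku ui] [Kv vi]; split; first by apply: KM => //; apply: KV.
  rewrite phiM ?phiV //; last exact: KV.
  by rewrite permM ui -[in LHS]vi permK.
pose F i := [set u | K u /\ phi u i0 = i].
have FE x : K x -> coset_of_set H x = F (phi x i0).
  move=> Kx; apply/seteqP; split=> [_ [h [Kh hi] <-]|u [Ku ui]].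
    by split; [apply: KM | rewrite phiM // permM hi].
  exists (u * x^-1); last by rewrite mulgVK.
  split; first by apply: KM => //; apply: KV.
  by rewrite phiM ?phiV //; [rewrite permM ui permK | apply: KV].
rewrite /has_index; have -> : coset_set H K = F @` [set: 'I_n.+1].
  apply/seteqP; split=> [_ [x Kx <-]|_ [i _ <-]]; first by exists (phi x i0); rewrite ?FE.
  by have [u Ku <-] := phi_tr i; exists u; rewrite ?FE.
apply: card_eq_trans (card_esym (@card_II n.+1)); apply: inj_card_eq.
move=> i j _ _ ij; have [u Ku ui] := phi_tr i.
have [_ <-] : F j u by rewrite -ij.
by rewrite ui.
Qed.

End CosetActions.

(** * Subgroups of index less than eight *)

Section LowerBound.
Local Open Scope classical_set_scope.
Local Open Scope card_scope.

(** Products of transvections represent all of [SOut 4] and act trivially on at most seven cosets,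
    so [H] is the only coset. *)
Lemma SOut_small_index (H : set (out (free_group 4))) :
  subgroup H (SOut 4) -> ~ (`I_8 #<= coset_set H (SOut 4)) -> H = SOut 4.
Proof.
move=> [Hgr HS] small; have Sgr := @SOut_group_closed 4.
have [phi [i0 [phiM phi1]]] := coset_perm_rep Sgr small.
have SoutT s : SOut 4 (outer (tprod s)).
  by rewrite /SOut /SLZ /= out_mxE det_tprod.
have triv s : phi (outer (tprod s)) = 1.
  apply: (perm7_rep_trivial (psi := fun s => phi (outer (tprod s)))) => [s1 s2|s1 s2 ->] //.
  by rewrite tprod_cat outerM phiM.
apply/seteqP; split=> // u; have [f ->] := outer_surj u.
rewrite /SOut /SLZ /= out_mxE => /special_aut_tprod[s ->].
have /phi1 /(_ _) : SOut 4 (outer (tprod s)) by [].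
rewrite triv perm1 => /(_ erefl) cE.
have [H1 _ _] := group_closedE Hgr.
have : coset_of_set H (outer (tprod s)) (outer (tprod s)) by exists 1; rewrite ?mul1g.
by rewrite cE => -[h Hh]; rewrite mulg1 => <-.
Qed.

(** The intersection with [SOut 4] has index below eight there, so [H] contains [SOut 4]; as the
    determinant has only two values, nothing lies strictly in between. *)
Lemma Out_small_index (H : set (out (free_group 4))) :
  group_closed (mem H) -> ~ (`I_8 #<= coset_set H [set: out (free_group 4)]) ->
  H = [set: out (free_group 4)] \/ H = SOut 4.
Proof.
move=> Hgr small; have [H1 HM HV] := group_closedE Hgr.
have Sgr := @SOut_group_closed 4; have [S1 SM SV] := group_closedE Sgr.
have SH : SOut 4 `<=` H.
  suff <- : H `&` SOut 4 = SOut 4 by move=> u [].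
  apply: SOut_small_index.
    split; last by move=> u [].
    split; first by rewrite inE.
    move=> u v; rewrite !inE => -[Hu Su] [Hv Sv].
    by split; [apply: HM => //; apply: HV | apply: SM => //; apply: SV].
  apply: contra_not small => /card_le_trans; apply.
  exact: coset_set_setI.
have [HS|/existsNP[u /not_implyP[Hu Su]]] := pselect (H `<=` SOut 4).
  by right; apply/seteqP.
left; apply/seteqP; split=> // v _.
have detS w : ~ SOut 4 w -> (\det (out_mx w) = -1)%R.
  rewrite /SOut /SLZ /= => nw; have := out_mx_unit w.
  by rewrite unitmxE => /orP[/eqP //|/eqP].
have [/SH //|Sv] := pselect (SOut 4 v).
rewrite -[v](mulgVK u); apply: HM => //; apply: SH.
have : (\det (out_mx (v * u^-1)%g) * \det (out_mx u) = \det (out_mx v))%R.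
  by rewrite -det_mulmx -out_mxM mulgVK.
rewrite (detS _ Su) (detS _ Sv) mulrN1 => /eqP.
by rewrite eqr_opp => /eqP.
Qed.

End LowerBound.

(** * The action of GL_4(2) on eight points *)

Section BitMatrices.
Local Open Scope ring_scope.

(* Matrices over the field with two elements, in a form that evaluates. *)
Definition bitmx := nat -> nat -> bool.
Implicit Types a b c : bitmx.

Definition mx_of_bits b : 'M['F_2]_4 := \matrix_(i, j) (b i j)%:R.
Definition bits_of_mx (M : 'M['F_2]_4) : bitmx :=
  fun i j => M (inord i) (inord j) != 0.

Definition addbit a b : bitmx := fun i j => a i j (+) b i j.
Definition mulbit a b : bitmx := fun i j =>
  let e k := a i k && b k j in e 0%N (+) e 1%N (+) (e 2%N (+) e 3%N).
(* Evaluates the entries once and for all, which avoids an exponential blow-up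
   in iterated products. *)
Definition memo a : bitmx :=
  let t := [seq [seq a i j | j <- iota 0%N 4%N] | i <- iota 0%N 4%N] in
  fun i j => nth false (nth [::] t i) j.
Definition trbit a : bitmx := fun i j => a j i.
Definition eqbit a b :=
  all (fun i => all (fun j => a i j == b i j) (iota 0%N 4%N)) (iota 0%N 4%N).

Lemma F2_bool (x : 'F_2) : x = (x != 0)%:R.
Proof. by case: x => [[|[|]]] // i; apply: val_inj. Qed.

Lemma bits_of_mxK : cancel bits_of_mx mx_of_bits.
Proof. by move=> M; apply/matrixP => i j; rewrite mxE /bits_of_mx !inord_val -F2_bool. Qed.

Lemma bit_inj (x y : bool) : x%:R = y%:R :> 'F_2 -> x = y.
Proof. by case: x y => [] [] // /eqP. Qed.

Lemma bitD (x y : bool) : x%:R + y%:R = (x (+) y)%:R :> 'F_2.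
Proof. by case: x y => [] []; apply: val_inj. Qed.

Lemma bitM (x y : bool) : x%:R * y%:R = (x && y)%:R :> 'F_2.
Proof. by case: x y => [] []; apply: val_inj. Qed.

Lemma mx_of_bitsD a b : mx_of_bits (addbit a b) = mx_of_bits a + mx_of_bits b.
Proof. by apply/matrixP => i j; rewrite !mxE bitD. Qed.

Lemma mx_of_bitsM a b : mx_of_bits (mulbit a b) = mx_of_bits a *m mx_of_bits b.
Proof.
apply/matrixP => i j; rewrite !mxE /mulbit !big_ord_recl big_ord0 addr0 !mxE.
by rewrite !bitM !bitD /= !addbA.
Qed.

Lemma mx_of_bits_memo a : mx_of_bits (memo a) = mx_of_bits a.
Proof.
apply/matrixP => i j; rewrite !mxE /memo (nth_map 0) ?size_iota //.
by rewrite (nth_map 0) ?size_iota // !nth_iota.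
Qed.

Lemma mx_of_bits_tr a : mx_of_bits (trbit a) = (mx_of_bits a)^T.
Proof. by apply/matrixP => i j; rewrite !mxE. Qed.

Lemma eqbitP a b : reflect (mx_of_bits a = mx_of_bits b) (eqbit a b).
Proof.
apply: (iffP idP) => [ab | ab].
  apply/matrixP => i j; rewrite !mxE.
  have /allP/(_ (val i)) := ab; rewrite mem_iota ltn_ord => /(_ isT).
  by move=> /allP/(_ (val j)); rewrite mem_iota ltn_ord => /(_ isT) /eqP->.
apply/allP => i; rewrite mem_iota => i4; apply/allP => j; rewrite mem_iota => j4.
have /matrixP/(_ (@Ordinal 4 i i4) (@Ordinal 4 j j4)) := ab.
by rewrite !mxE /= => /bit_inj->.
Qed.

End BitMatrices.

(** * Eight alternating forms and the permutations compatible with a matrix *)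

Section EightPoints.
Local Open Scope ring_scope.

(* Eight alternating forms whose pairwise differences are the 28 nondegenerate
   ones, each given by its entries 01, 02, 03, 12, 13, 23. *)
Definition form_entries : seq (seq bool) :=
  [:: [:: false; false; false; false; false; false];
      [:: false; false; true; true; false; false];
      [:: false; true; true; false; true; false];
      [:: true; true; false; true; true; false];
      [:: true; true; true; false; false; true];
      [:: true; false; false; true; false; true];
      [:: true; false; true; false; true; true];
      [:: false; true; false; true; true; true]].

Definition form_bits (a : nat) : bitmx := fun i j =>
  let e := nth [::] form_entries a in
  match minn i j, maxn i j with
  | 0, 1 => nth false e 0 | 0, 2 => nth false e 1 | 0, 3 => nth false e 2
  | 1, 2 => nth false e 3 | 1, 3 => nth false e 4 | 2, 3 => nth false e 5
  | _, _ => false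
  end%N.

Definition diff_bits (a b : nat) : bitmx := addbit (form_bits a) (form_bits b).
Definition diff (a b : 'I_8) : 'M['F_2]_4 := mx_of_bits (diff_bits a b).

Implicit Types (g h : 'M['F_2]_4) (s t : 'S_8).

(** Only differences are compared, since a matrix permutes the eight forms up to a common
    translation. *)
Definition compat g s : bool :=
  [forall a, forall b, g^T *m diff a b *m g == diff (s a) (s b)].

Lemma compatP g s :
  reflect (forall a b, g^T *m diff a b *m g = diff (s a) (s b)) (compat g s).
Proof.
apply: (iffP forallP) => [gs a b | gs a]; first by apply/eqP/(forallP (gs a)).
by apply/forallP => b; apply/eqP.
Qed.

Lemma compatM g h s t : compat g s -> compat h t -> compat (g *m h) (s * t)%g.
Proof.
move=> /compatP gs /compatP ht; apply/compatP => a b.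
by rewrite trmx_mul !permM -ht -gs !mulmxA.
Qed.

Lemma compat1 : compat 1%:M 1%g.
Proof. by apply/compatP => a b; rewrite trmx1 mul1mx mulmx1 !perm1. Qed.

Lemma diff_inj (a b c d : 'I_8) : a != b -> diff a b = diff c d ->
  (c == a) && (d == b) || (c == b) && (d == a).
Proof.
have chk : all (fun a => all (fun b => all (fun c => all (fun d =>
    (a != b) && eqbit (diff_bits a b) (diff_bits c d) ==>
      (c == a) && (d == b) || (c == b) && (d == a))
    (iota 0%N 8%N)) (iota 0%N 8%N)) (iota 0%N 8%N)) (iota 0%N 8%N) by vm_compute.
move=> ab /eqbitP abcd.
have io (x : 'I_8) : val x \in iota 0%N 8%N by rewrite mem_iota ltn_ord.
have := allP (allP (allP (allP chk _ (io a)) _ (io b)) _ (io c)) _ (io d).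
by rewrite abcd andbT => /implyP/(_ ab).
Qed.

(** A difference determines its unordered pair. If [t a] were not [s a], it would equal [s b] for
    every [b] other than [a], which two choices of [b] refute. *)
Lemma compat_perm_uniq g s t : compat g s -> compat g t -> s = t.
Proof.
move=> /compatP gs /compatP gt; apply/permP => a.
have st b : b != a ->
    (t a == s a) && (t b == s b) || (t a == s b) && (t b == s a).
  by move=> ba; apply: diff_inj; rewrite ?(inj_eq perm_inj) 1?eq_sym // -gs -gt.
have [b ba] : exists b : 'I_8, b != a.
  by exists (if a == ord0 then ord_max else ord0); case: ifP => [/eqP->|/negbT]; rewrite 1?eq_sym.
have [c /andP[ca cb]] : exists c : 'I_8, (c != a) && (c != b).
  have : has (fun n : nat => (n != a) && (n != b)) (iota 0%N 3%N) by rewrite /=; lia.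
  case/hasP=> n; rewrite mem_iota => /= n3 nab.
  have n8 : (n < 8)%N by apply: ltn_trans n3 _.
  by exists (Ordinal n8).
have /orP[/andP[/eqP-> //]|/andP[/eqP tab _]] := st b ba.
have /orP[/andP[/eqP-> //]|/andP[/eqP tac _]] := st c ca.
by case/eqP: cb; apply: (@perm_inj _ s); rewrite -tab.
Qed.

Definition elem_bits (k l : nat) : bitmx := fun i j =>
  ((i == k) && (j == l)) || ((i == l) && (j == k)).

(** The differences span the alternating forms, so a matrix that fixes every difference fixes every
    elementary alternating form. *)
Lemma elem_form_diff : all (fun k => all (fun l => (k < l)%N ==>
  has (fun a => has (fun b => has (fun c =>
    eqbit (elem_bits k l) (addbit (diff_bits a b) (diff_bits c 0%N)))
  (iota 0%N 8%N)) (iota 0%N 8%N)) (iota 0%N 8%N)) (iota 0%N 4%N)) (iota 0%N 4%N).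
Proof. by vm_compute. Qed.

(* The 2 x 2 minors of the rows k and l of g are those of the identity. *)
Lemma wedge_id (g : bitmx) :
  (forall k l, (k < l < 4)%N ->
    eqbit (mulbit (mulbit (trbit g) (elem_bits k l)) g) (elem_bits k l)) ->
  eqbit g (fun i j => i == j).
Proof.
move=> gX.
have minor k l i j : (k < 4 -> l < 4 -> i < 4 -> j < 4 -> k != l ->
    (g k i && g l j) (+) (g l i && g k j) = elem_bits k l i j)%N.
  move=> k4 l4 i4 j4 kl.
  wlog lkl : k l k4 l4 kl / (k < l)%N.
    move=> W; have [h|h|h] := ltngtP k l; [|  | by rewrite h eqxx in kl].
    by apply: W.
    have lk : l != k by rewrite eq_sym.
    by rewrite addbC (W l k l4 k4 lk h) /elem_bits orbC.
  have /gX/allP/(_ i) : (k < l < 4)%N by rewrite lkl.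
  rewrite mem_iota => /(_ i4)/allP/(_ j); rewrite mem_iota => /(_ j4)/eqP<-.
  have klE : (k, l) \in [:: (0, 1); (0, 2); (0, 3); (1, 2); (1, 3); (2, 3)]%N.
    by clear - k4 l4 lkl; case: k l k4 l4 lkl => [|[|[|[|k]]]] [|[|[|[|l]]]].
  move: klE; rewrite !inE /mulbit /trbit /elem_bits => {gX k4 l4 i4 j4 kl lkl}.
  by do ![case/orP]=> /eqP[-> ->] /=;
    case: (g 0%N i); case: (g 1%N i); case: (g 2%N i); case: (g 3%N i);
    case: (g 0%N j); case: (g 1%N j); case: (g 2%N j); case: (g 3%N j).
have third i j : (i < 4 -> j < 4 -> exists l, [/\ l < 4, i != l & j != l])%N.
  move=> i4 j4; suff : has (fun l => (i != l) && (j != l)) (iota 0%N 4%N).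
    by case/hasP=> l; rewrite mem_iota => /= l4 /andP[il jl]; exists l.
  by rewrite /=; lia.
(* If [g i j] were 1, then in rows [i] and [l] the columns [i] and [l] would both be multiples of
   the nonzero column [j], so their minor would vanish instead of being 1. *)
have off i j : (i < 4 -> j < 4 -> i != j -> g i j = false)%N.
  move=> i4 j4 ij; have [l [l4 il jl]] := third i j i4 j4.
  move: (minor i l i l i4 l4 i4 l4 il) (minor i l j l i4 l4 j4 l4 il)
    (minor i l j i i4 l4 j4 i4 il).
  rewrite /elem_bits !eqxx (eq_sym j i) (negPf ij) (negPf il) (negPf jl) /=.
  case: (g i j) => //; clear.
  by case: (g i i); case: (g l l); case: (g l j); case: (g i l); case: (g l i).
apply/allP => i; rewrite mem_iota add0n => i4.
apply/allP => j; rewrite mem_iota add0n => j4.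
have [<-|ij] := eqVneq i j; last by rewrite off.
have [l [l4 il _]] := third i i i4 i4.
have := minor i l i l i4 l4 i4 l4 il; rewrite /elem_bits !eqxx /=.
by rewrite (off i l) // andbF addbF; case: (g i i).
Qed.

(** The quotient of [g] by [h] fixes all differences, hence all elementary alternating forms, and
    [wedge_id] applies. *)
Lemma compat_mx_uniq g h s : h \in unitmx -> compat g s -> compat h s -> g = h.
Proof.
move=> hU /compatP gs /compatP hs.
suff : g *m invmx h = 1%:M by move/(congr1 (mulmx^~ h)); rewrite mulmxKV // mul1mx.
set k := g *m invmx h.
have kD a b : k^T *m diff a b *m k = diff a b.
  have -> : k^T *m diff a b *m k =
      (invmx h)^T *m (g^T *m diff a b *m g) *m invmx h.
    by rewrite /k trmx_mul !mulmxA.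
  rewrite gs -hs -!mulmxA mulmxV // mulmx1 !mulmxA -trmx_mul mulmxV //.
  by rewrite trmx1 mul1mx.
have kE := bits_of_mxK k.
have -> : 1%:M = mx_of_bits (fun i j => i == j) :> 'M['F_2]_4.
  by apply/matrixP => i j; rewrite !mxE.
rewrite -kE; apply/eqbitP/wedge_id => p q /andP[pq q4].
have p4 := ltn_trans pq q4.
have io x n : (x < n)%N -> x \in iota 0 n by rewrite mem_iota.
have := allP (allP elem_form_diff p (io p 4 p4)) q (io q 4 q4).
move/implyP/(_ pq)/hasP=> [a + /hasP[b + /hasP[c + /eqbitP eE]]].
rewrite !mem_iota !add0n => a8 b8 c8.
apply/eqbitP; rewrite !mx_of_bitsM mx_of_bits_tr kE eE mx_of_bitsD.
rewrite mulmxDr mulmxDl; congr (_ + _).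
  exact: (kD (Ordinal a8) (Ordinal b8)).
exact: (kD (Ordinal c8) ord0).
Qed.

Definition swapn (a b x : nat) := if x == a then b else if x == b then a else x.

Lemma tperm_swapn (a b x : 'I_8) : tperm a b x = swapn a b x :> nat.
Proof. by rewrite permE /= /swapn -!val_eqE /=; case: eqP => //; case: eqP. Qed.

(* A product of two orthogonal transvections along nondegenerate forms A and B
   is induced by A^-1 B; here A is the antidiagonal form_bits 1, an
   involution. *)
Definition tperm_pair_bits (a b : nat) : bitmx :=
  memo (mulbit (form_bits 1%N) (diff_bits a b)).

Lemma compat_tperm_pair (a b : 'I_8) : a != b -> exists2 g,
  g \in unitmx & compat g (tperm ord0 (inord 1%N) * tperm a b)%g.
Proof.
have chk : all (fun a => all (fun b => (a != b) ==>
    (let g := tperm_pair_bits a b in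
     all (fun c => all (fun d => eqbit (mulbit (memo (mulbit (trbit g) (diff_bits c d))) g)
        (diff_bits (swapn a b (swapn 0%N 1%N c)) (swapn a b (swapn 0%N 1%N d))))
     (iota 0%N 8%N)) (iota 0%N 8%N) &&
     (* A product of two transpositions has order dividing 6; correspondingly the square of the cube
        [h] is the identity, which proves [g] invertible. *)
     let h := memo (mulbit g (memo (mulbit g g))) in
     eqbit (mulbit h h) (fun i j => i == j)))
  (iota 0%N 8%N)) (iota 0%N 8%N) by vm_compute.
have io (x : 'I_8) : val x \in iota 0%N 8%N by rewrite mem_iota ltn_ord.
move=> ab; have /implyP/(_ ab) := allP (allP chk _ (io a)) _ (io b).
move: (tperm_pair_bits a b) => g /andP[ch /eqbitP].
rewrite !(mx_of_bitsM, mx_of_bits_memo) -mulmxA => g6.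
exists (mx_of_bits g).
  have one : mx_of_bits (fun i j => i == j) = 1%:M by apply/matrixP => i j; rewrite !mxE.
  by rewrite one in g6; case: (mulmx1_unit g6).
apply/compatP => c d; have /eqbitP := allP (allP ch _ (io c)) _ (io d).
rewrite mx_of_bitsM mx_of_bits_memo mx_of_bitsM mx_of_bits_tr => ->.
by rewrite /diff !permM !tperm_swapn inordK.
Qed.

(** In a product of transpositions, every prefix of odd length is made even by a trailing [t].
    Adding a factor [p] then amounts to multiplying by [t * p] or by its inverse. *)
Lemma compat_Alt s : s \in 'Alt_('I_8) -> exists2 g, g \in unitmx & compat g s.
Proof.
pose t : 'S_8 := tperm ord0 (inord 1%N).
have t2 : (t * t = 1)%g by apply: tperm2.
have t01 : ord0 != inord 1%N :> 'I_8 by rewrite -val_eqE /= inordK.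
have [ts -> tsn] := prod_tpermP s; rewrite Alt_even odd_perm_prod // => evenp.
suff : exists2 g, g \in unitmx &
    compat g ((\prod_(p <- ts) tperm p.1 p.2) * t ^+ odd (size ts))%g.
  by rewrite (negPf evenp) mulg1.
have VT g s' : g \in unitmx -> compat g s' -> compat (invmx g) (s'^-1)%g.
  move=> gU /compatP gs; apply/compatP => a b.
  rewrite -[a in diff a]((permKV s') a) -[b in diff _ b]((permKV s') b) -gs !mulmxA.
  by rewrite trmx_inv mulVmx ?unitmx_tr // mul1mx mulmxK ?permKV.
elim/last_ind: ts tsn {evenp} => [|ts p IHts].
  by exists 1%:M; [apply: unitmx1 | rewrite big_nil mulg1; apply: compat1].
rewrite all_rcons => /andP[pn /IHts[g gU gs]].
have [h hU hs] := compat_tperm_pair pn.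
rewrite -cats1 big_cat big_seq1 size_cat addn1 /=.
case: (odd (size ts)) gs => /= gs.
  exists (g *m h); first by rewrite unitmx_mul gU.
  have := compatM gs hs; rewrite expg1 expg0 mulg1 mulgA -[(_ * t * t)%g]mulgA t2 mulg1.
  by [].
exists (g *m invmx h); first by rewrite unitmx_mul gU unitmx_inv.
have := compatM gs (VT _ _ hU hs).
by rewrite expg0 mulg1 invgM !tpermV mulgA.
Qed.
End EightPoints.

(** * Alternating groups and minimal indices *)

Section SimpleIndex.
Implicit Types gT : finGroupType.

(** The core of a proper subgroup of a simple group is trivial, so [G] acts faithfully on the
    cosets. *)
Lemma simple_index_fact gT (G H : {group gT}) :
  simple G -> H \proper G -> #|G| <= (#|G : H|)`!.
Proof.
move=> /simpleP[_ simG] HG.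
have nSA : actby_cond G (rcosets H G) 'Rs by apply: actsRs_rcosets.
have coreE : gcore H G = 1.
  have sub : gcore H G \subset H := gcore_sub H G.
  have [//|gE] := simG (gcore H G)%G (gcore_normal (proper_sub HG)).
  by move: sub; rewrite gE => GH; case/negP: (proper_subn HG).
have ffG : [faithful G, on rcosets H G | 'Rs].
  by rewrite /faithful astabRs_rcosets coreE subsetIr.
rewrite (isom_card (faithful_isom nSA ffG)).
rewrite -(perm.card_Sym (rcosets H G)); apply: subset_leq_card.
apply/fintype.subsetP => _ /morphimP[a _ Ga ->]; rewrite inE.
apply/fintype.subsetP => x; rewrite inE actpermE /= /actby.
by case: (x \in _) => //; rewrite eqxx.
Qed.

Lemma simple_Alt8 : simple 'Alt_('I_8).
Proof. by apply: simple_Alt5; rewrite card_ord. Qed.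

Lemma card_Alt8 : #|'Alt_('I_8)| = (8`!)./2.
Proof.
by rewrite -[X in X`!](card_ord 8) -card_Alt ?card_ord // mul2n doubleK.
Qed.

Lemma simple_nonabelian_center gT (G : {group gT}) :
  simple G -> ~~ prime #|G| -> 'Z(G) = 1.
Proof.
move=> sG nprime; have /simpleP[_ simG] := sG.
have [//|/center_idP cGG] := simG _ (center_normal G).
by case/negP: nprime; apply: simple_sol_prime sG; apply: abelian_sol.
Qed.

Lemma index_ge8 gT (G H : {group gT}) :
  G \isog 'Alt_('I_8) -> H \proper G -> 8 <= #|G : H|.
Proof.
move=> GA HG; have sG : simple G by rewrite (isog_simple GA) simple_Alt8.
have := simple_index_fact sG HG; rewrite (card_isog GA) card_Alt8.
(* Here [7! = 5040] is less than [8!/2 = 20160]. *)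
by case: #|G : H| => [|[|[|[|[|[|[|[|m]]]]]]]] //; vm_compute.
Qed.

Lemma exists_index8 gT (G : {group gT}) : G \isog 'Alt_('I_8) ->
  exists H : {group gT}, H \proper G /\ #|G : H| = 8.
Proof.
rewrite isog_sym => /isogP[f injf fG].
have trA : [transitive 'Alt_('I_8), on [set: 'I_8] | 'P].
  have := @Alt_trans 'I_8; rewrite card_ord => tr6.
  exact: ntransitive1 tr6.
pose H := ('C_('Alt_('I_8))[ord0 | 'P])%G.
have HA : H \subset 'Alt_('I_8) by apply: subsetIl.
have iH : #|'Alt_('I_8) : H| = 8.
  by rewrite -card_orbit (atransP trA) ?inE // cardsT card_ord.
have ifH : #|f @* 'Alt_('I_8) : f @* H| = 8.
  by rewrite index_injm.
exists (f @* H)%G; rewrite /= -fG; split=> //.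
by rewrite properE morphimS // -indexg_eq1 ifH.
Qed.

End SimpleIndex.

(** * The isomorphisms of SL_4(2) and PSL_4(2) with A_8 *)

Section SL42.

Lemma SL42_full : SL 4 'F_2 = [set: {'GL_4['F_2]}].
Proof.
apply/setP => u; rewrite !inE; have := GL_unit u.
rewrite -[_ \is a _]/(GLval u \in unitmx) unitmxE unitfE.
by case: (\det _)%R => [[|[|]]].
Qed.

Lemma card_GL42 : #|[set: {'GL_4['F_2]}]| = (8`!)./2.
Proof.
have := card_GL 'F_2 (isT : 0 < 4) => ->.
rewrite card_Fp; last by [].
by rewrite unlock; vm_compute.
Qed.

Definition Alt_to_GL (s : 'S_8) : {'GL_4['F_2]} :=
  odflt 1 [pick g : {'GL_4['F_2]} | compat (GLval g) s].

Lemma GLval_surj (g : 'M['F_2]_4) :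
  g \in unitmx -> exists u : {'GL_4['F_2]}, GLval u = g.
Proof. by move=> gU; exists (FinRing.unit 'M['F_2]_4 gU). Qed.

Lemma compat_Alt_to_GL s : s \in 'Alt_('I_8) -> compat (GLval (Alt_to_GL s)) s.
Proof.
move=> /compat_Alt[g /GLval_surj[u <-] us]; rewrite /Alt_to_GL.
by case: pickP => [//|/(_ u)]; rewrite us.
Qed.

Lemma GL_compat_uniq (g h : {'GL_4['F_2]}) s :
  compat (GLval g) s -> compat (GLval h) s -> g = h.
Proof.
move=> gs hs; apply: val_inj; apply: compat_mx_uniq gs hs.
exact: (GL_unit h : GLval h \in unitmx).
Qed.

Lemma Alt_to_GLM : {in 'Alt_('I_8) &, {morph Alt_to_GL : s t / s * t}}.
Proof.
move=> s t sA tA; apply: (@GL_compat_uniq _ _ (s * t)).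
  by apply: compat_Alt_to_GL; apply: groupM.
by rewrite GL_MxE; apply: compatM; apply: compat_Alt_to_GL.
Qed.
Canonical Alt_to_GL_morphism := Morphism Alt_to_GLM.

Lemma injm_Alt_to_GL : 'injm Alt_to_GL_morphism.
Proof.
apply/injmP => s t sA tA /= st; apply: compat_perm_uniq (compat_Alt_to_GL sA) _.
by rewrite st; apply: compat_Alt_to_GL.
Qed.

Lemma im_Alt_to_GL : Alt_to_GL_morphism @* 'Alt_('I_8) = [set: {'GL_4['F_2]}].
Proof.
apply/eqP; rewrite eqEcard finset.subsetT card_injm ?injm_Alt_to_GL //.
by rewrite card_GL42 card_Alt8 leqnn.
Qed.

(** That every invertible matrix permutes the eight forms up to translation is not checked case by
    case; it follows from the surjectivity of [Alt_to_GL]. *)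
Lemma exists_compat (g : 'M['F_2]_4) : g \in unitmx -> exists s, compat g s.
Proof.
move=> /GLval_surj[u <-]; have : u \in Alt_to_GL_morphism @* 'Alt_('I_8).
  by rewrite im_Alt_to_GL inE.
case/morphimP=> s _ sA uE; exists s; rewrite uE.
exact: compat_Alt_to_GL.
Qed.

Lemma SL42_isog_Alt : SL 4 'F_2 \isog 'Alt_('I_8).
Proof.
have := sub_isog (subxx 'Alt_('I_8)) injm_Alt_to_GL.
by rewrite im_Alt_to_GL isog_sym SL42_full.
Qed.

(** The center of a nonabelian simple group is trivial, so dividing by it changes nothing. *)
Lemma PSL42_isog_Alt : PSL 4 'F_2 \isog 'Alt_('I_8).
Proof.
apply: isog_trans SL42_isog_Alt; rewrite isog_sym.
have Z1 : 'Z(SL 4 'F_2) = 1.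
  apply: (@simple_nonabelian_center _ (SL_group 4 'F_2)).
    by rewrite (isog_simple SL42_isog_Alt) simple_Alt8.
  by rewrite (card_isog SL42_isog_Alt) card_Alt8.
apply: (@quotient_isog _ _ (SL_group 4 'F_2)).
  by apply: normal_norm; apply: center_normal.
have ZI : 'Z(SL 4 'F_2) :&: SL 4 'F_2 = 1.
  by rewrite Z1; apply/trivgP; apply: subsetIl.
exact: ZI.
Qed.

End SL42.

(** * The action of Out F_4 on eight points *)

Section Index8.
Local Open Scope classical_set_scope.

Definition out_mx2 (u : out (free_group 4)) : 'M['F_2]_4 := map_mx intr (out_mx u).

Lemma out_mx2M u v : out_mx2 (u * v) = (out_mx2 u *m out_mx2 v)%R.
Proof. by rewrite /out_mx2 out_mxM map_mxM. Qed.

Lemma out_mx2_unit u : out_mx2 u \in unitmx.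
Proof.
have : (out_mx2 u *m out_mx2 u^-1%g = 1%:M)%R.
  by rewrite -out_mx2M mulgV /out_mx2 out_mx1 map_mx1.
by case/mulmx1_unit.
Qed.

Definition out_perm8 (u : out (free_group 4)) : 'S_8 :=
  odflt 1 [pick s : 'S_8 | compat (out_mx2 u) s].

Lemma compat_out_perm8 u : compat (out_mx2 u) (out_perm8 u).
Proof.
have [s us] := exists_compat (out_mx2_unit u); rewrite /out_perm8.
by case: pickP => [//|/(_ s)]; rewrite us.
Qed.

Lemma out_perm8M u v : out_perm8 (u * v) = out_perm8 u * out_perm8 v.
Proof.
apply: compat_perm_uniq (compat_out_perm8 _) _; rewrite out_mx2M.
by apply: compatM; apply: compat_out_perm8.
Qed.

Definition elem2_bits (k l : nat) : bitmx :=
  fun i j => (i == j) || (i == k) && (j == l).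

Lemma out_mx2_transv (k l : 'I_4) : k != l ->
  out_mx2 (outer (transv ((l, true), (k, true)))) = mx_of_bits (elem2_bits k l).
Proof.
move=> kl; rewrite /out_mx2 out_mxE; apply/matrixP => i j.
rewrite !mxE /= extend_gen.
rewrite /transv_gen /= [l == k]eq_sym kl andbT.
have -> : elem2_bits k l i j = (i == j) || (i == k) && (j == l) by [].
have [->|jl] := eqVneq j l; last first.
  by rewrite ab_fgen mxE eqxx !andbT andbF orbF; case: (i == j).
rewrite abM !ab_lt /ab_letter /= !mxE !eqxx !andbT.
by have [->|il] := eqVneq i l; [rewrite eq_sym (negPf kl) | case: (i == k)].
Qed.

(* A permutation compatible with g can only move the point 0 to a. *)
Definition moves_zero_to (g : bitmx) (a : nat) : bool :=
  all (fun c => (c == a) || has (fun b => all (fun d =>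
    ~~ eqbit (mulbit (memo (mulbit (trbit g) (diff_bits 0%N b))) g) (diff_bits c d))
  (iota 0%N 8%N)) (iota 0%N 8%N)) (iota 0%N 8%N).

(* Each target point a, with the position of the off-diagonal entry of a
   transvection that moves 0 to a. *)
Definition zero_moves : seq (nat * (nat * nat)) :=
  [:: (3, (0, 1)); (2, (0, 2)); (3, (1, 3)); (1, (0, 4)); (0, (1, 5));
      (2, (3, 6)); (0, (2, 7))]%N.

Lemma out_perm8_transitive (a : 'I_8) :
  exists2 u, SOut 4 u & out_perm8 u ord0 = a.
Proof.
have [->|a0] := eqVneq a ord0.
  exists 1; first by rewrite /SOut /SLZ /= out_mx1 det1.
  have : out_perm8 1 = 1 by apply: (mulgI (out_perm8 1)); rewrite -out_perm8M !mulg1.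
  by move=> ->; rewrite perm1.
have chk : all (fun p => (p.1 != p.2.1) && (p.1 < 4) && (p.2.1 < 4) &&
    moves_zero_to (elem2_bits p.1 p.2.1) p.2.2)
    zero_moves by vm_compute.
have /hasP[[k [l c]] kl /= /eqP cE] : has (fun p => p.2.2 == val a) zero_moves.
  by clear chk; case: a a0 => [[|[|[|[|[|[|[|[|a]]]]]]]] ai].
have /andP[/andP[/andP[/= klN k4] l4] mv] := allP chk _ kl.
pose u := outer (transv ((Ordinal l4, true), (Ordinal k4, true))).
exists u; first by rewrite /SOut /SLZ /= out_mxE det_transv.
have := compat_out_perm8 u; rewrite out_mx2_transv // => /compatP uE.
have io (x : 'I_8) : val x \in iota 0%N 8%N by rewrite mem_iota ltn_ord.
have := allP mv _ (io (out_perm8 u ord0)); rewrite cE.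
case/orP=> [/eqP ua|]; first exact: val_inj.
(* Any other image of 0 comes with a point [b] for which no image is possible, whereas [out_perm8 u]
   provides one. *)
case/hasP=> b; rewrite mem_iota add0n => b8 /allP/(_ _ (io (out_perm8 u (Ordinal b8)))).
case/negP; apply/eqbitP.
rewrite mx_of_bitsM mx_of_bits_memo mx_of_bitsM mx_of_bits_tr.
exact: (uE ord0 (Ordinal b8)).
Qed.

End Index8.

Theorem mainTheorem2 :
  [/\ minimal_index (fun H => H <> SOut 4) (SOut 4) 8,
      minimal_index (fun H => H <> setT /\ H <> SOut 4)
        (@setT (out (free_group 4))) 8,
      (exists H : {group coset_of 'Z(SL 4 'F_2)},
          H \proper PSL 4 'F_2 /\ #|PSL 4 'F_2 : H| = 8) /\
      (forall H : {group coset_of 'Z(SL 4 'F_2)},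
          H \proper PSL 4 'F_2 -> 8 <= #|PSL 4 'F_2 : H|) &
      PSL 4 'F_2 \isog Alt 'I_8].
Proof.
have phiM K u v : K u -> K v -> out_perm8 (u * v) = out_perm8 u * out_perm8 v.
  by move=> _ _; apply: out_perm8M.
have Tgr : group_closed (mem (@setT (out (free_group 4)))).
  by split=> [|u v]; rewrite !inE.
(* An element of [SOut 4] that moves the point 0: it shows that the stabilizer of 0 is proper in
   [SOut 4], and that the one in the whole group is neither everything nor [SOut 4]. *)
have [u Su u1] := out_perm8_transitive (inord 1).
have u0 : out_perm8 u ord0 <> ord0.
  by rewrite u1 => /(congr1 val); rewrite /= inordK.
split.
- split.
    have [Hs Hi] := point_stabilizer_index (@SOut_group_closed 4)
      (@phiM _) out_perm8_transitive.
    eexists; split; [exact: Hs | | exact: Hi].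
    by move=> HE; apply: u0; have : SOut 4 u by []; rewrite -[X in X u]HE => -[].
  move=> H sH HN; apply: contrapT => small; apply: HN.
  exact: SOut_small_index sH small.
- split.
    have tr i : exists2 v, @setT (out (free_group 4)) v & out_perm8 v ord0 = i.
      by have [v _ vi] := out_perm8_transitive i; exists v.
    have [Hs Hi] := point_stabilizer_index Tgr (@phiM _) tr.
    eexists; split; [exact: Hs | | exact: Hi].
    split=> HE; apply: u0.
      by have : @setT (out (free_group 4)) u by []; rewrite -[X in X u]HE => -[].
    by have : SOut 4 u by []; rewrite -[X in X u]HE => -[].
  move=> H [Hgr _] [HT HS]; apply: contrapT => small.
  by case: (Out_small_index Hgr small).
- split; first exact: (exists_index8 PSL42_isog_Alt).
  by move=> H; apply: index_ge8 PSL42_isog_Alt.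
- exact: PSL42_isog_Alt.
Qed.
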